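(* Let $\mathcal M=\mathbb R\times\mathcal N$ with structure $(\phi,\xi,\eta,g^L)$ be the Sasakian lift of a Kähler manifold $(\mathcal N,J,g)$ with Kähler form $\omega=d\tau$, and let $V$ be an infinitesimal automorphism of the Kähler structure of $\mathcal N$. Then there is a locally defined function $f$ on $\mathcal M$ with $df(\xi)=0$ such that the vector field $U_V=V^L+f\xi$ is a local infinitesimal automorphism of the almost contact metric structure $(\phi,\xi,\eta,g^L)$.
   Context: Conventions: $2\,d\theta(X,Y)=X\theta(Y)-Y\theta(X)-\theta([X,Y])$ for a 1-form $\theta$. On a Kähler manifold $(\mathcal N,J,g)$, $\dim\mathcal N=2n$, the Kähler form is $\omega(X,Y)=g(X,JY)$; it is assumed that there is a global 1-form $\tau$ with $\omega=d\tau$. A vector field $V$ is an (infinitesimal) automorphism of the Kähler structure if two, equivalently all three, of $\mathcal L_VJ=0$, $\mathcal L_Vg=0$, $\mathcal L_V\omega=0$ hold. Sasakian lift: $\mathcal M=\mathbb R\times\mathcal N$ with projection $\pi_2:\mathcal M\to\mathcal N$ and coordinate $t$ on $\mathbb R$; $\xi=\partial_t$, $\eta=dt+\pi_2^*\tau$. A vector field $X$ on $\mathcal N$ is lifted to $X^L=X-(\tau(X)\circ\pi_2)\,\xi$ on $\mathcal M$. The $(1,1)$-tensor $\phi$ and metric $g^L$ are determined by $\phi X^L=(JX)^L$, $\phi\xi=0$, $g^L=\eta\otimes\eta+\pi_2^*g$. A local infinitesimal automorphism of $(\phi,\xi,\eta,g^L)$ is a locally defined vector field $U$ whose Lie derivative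 annihilates the structure tensors ($\mathcal L_U\phi=0$, $\mathcal L_U\xi=0$, $\mathcal L_U\eta=0$, $\mathcal L_Ug^L=0$). ''Locally defined'' means on a neighbourhood of any given point. *)

(* Defs.v *)
From HB Require Import structures.
From mathcomp Require Import all_boot all_order all_algebra.
From mathcomp Require Import all_classical all_reals all_analysis.

Set Implicit Arguments.
Unset Strict Implicit.
Unset Printing Implicit Defensive.
Import Order.TTheory GRing.Theory Num.Theory.
Import numFieldNormedType.Exports.

Local Open Scope classical_set_scope.
Local Open Scope ring_scope.

(* The differential of f is tested along each fixed vector v; in finite
   dimension this is the usual C^k condition on an open set U. *)
Fixpoint Ck (R : realType) (V W : normedModType R) (k : nat) (U : set V)
    (f : V -> W) : Prop :=
  if k is k'.+1 then
    (forall x, U x -> differentiable f x) /\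
    (forall v : V, Ck k' U (fun x => 'd f x v))
  else forall x, U x -> {for x, continuous f}.

Definition smooth_on (R : realType) (V W : normedModType R) (U : set V)
    (f : V -> W) : Prop :=
  forall k, Ck k U f.

(* An atlas comes with a preferred chart around each point and consists of these
   preferred charts.  The values of [chart] outside [dom], and of [chart_inv]
   outside the image of [dom], are junk. *)
Record atlas (R : realType) (m : nat) (N : Type) := Atlas {
  dom : N -> set N ;
  chart : N -> N -> 'rV[R]_m ;
  chart_inv : N -> 'rV[R]_m -> N }.

Record is_manifold (R : realType) (m : nat) (N : topologicalType)
    (A : atlas R m N) : Prop := IsManifold {
  manifold_hausdorff : hausdorff_space N ;
  manifold_second_countable : @second_countable N ;
  dom_open : forall p, open (dom A p) ;
  dom_center : forall p, dom A p p ;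
  chart_open : forall p, open (chart A p @` dom A p) ;
  chartK : forall p x, dom A p x -> chart_inv A p (chart A p x) = x ;
  chart_continuous : forall p x, dom A p x -> {for x, continuous (chart A p)} ;
  chart_inv_continuous : forall p y, (chart A p @` dom A p) y ->
    {for y, continuous (chart_inv A p)} ;
  chart_compatible : forall p q,
    smooth_on (chart A p @` (dom A p `&` dom A q))
              (chart A q \o chart_inv A p) }.

(* The tangent space at p is 'rV[R]_m: a vector at p is given by its components
   in the coordinate frame of the preferred chart at p. *)
Definition vfield (R : realType) (m : nat) (N : Type) := N -> 'rV[R]_m.
Definition form1 (R : realType) (m : nat) (N : Type) := N -> 'rV[R]_m -> R.
Definition bilin (R : realType) (m : nat) (N : Type) :=
  N -> 'rV[R]_m -> 'rV[R]_m -> R.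
Definition endo (R : realType) (m : nat) (N : Type) :=
  N -> 'rV[R]_m -> 'rV[R]_m.

Section Calculus.
Context {R : realType} {m : nat} {N : topologicalType} (A : atlas R m N).
Implicit Types (W : set N) (p : N) (f : N -> R) (X Y Z U : vfield R m N).
Implicit Types (th : form1 R m N) (b : bilin R m N) (T : endo R m N).

(* The components of X in the chart at p, as a function of the coordinates. *)
Definition in_chart p X (y : 'rV[R]_m) : 'rV[R]_m :=
  let q := chart_inv A p y in
  'd (chart A p \o chart_inv A q) (chart A q q) (X q).

Definition smooth_fun W f : Prop :=
  forall p, smooth_on (chart A p @` (W `&` dom A p)) (f \o chart_inv A p).

Definition smooth_vfield W X : Prop :=
  forall p, smooth_on (chart A p @` (W `&` dom A p)) (in_chart p X).

Definition der X f : N -> R :=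
  fun p => 'd (f \o chart_inv A p) (chart A p p) (X p).

Definition bracket X Y : vfield R m N :=
  fun p => 'd (in_chart p Y) (chart A p p) (X p)
         - 'd (in_chart p X) (chart A p p) (Y p).

Definition app1 th X : N -> R := fun p => th p (X p).
Definition app2 b X Y : N -> R := fun p => b p (X p) (Y p).
Definition appe T X : vfield R m N := fun p => T p (X p).

Definition is_form1 th : Prop :=
  (forall p, scalar (th p)) /\
  (forall W X, open W -> smooth_vfield W X -> smooth_fun W (app1 th X)).

Definition is_endo T : Prop :=
  (forall p, linear (T p)) /\
  (forall W X, open W -> smooth_vfield W X -> smooth_vfield W (appe T X)).

Definition is_metric b : Prop :=
  [/\ forall p u, scalar (b p u),
      forall p u v, b p u v = b p v u,
      forall p u, u != 0 -> 0 < b p u u &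
      forall W X Y, open W -> smooth_vfield W X -> smooth_vfield W Y ->
        smooth_fun W (app2 b X Y)].

(* Evaluated on local fields; normalized by
   2 dth(X,Y) = X th(Y) - Y th(X) - th([X,Y]). *)
Definition dform1 th X Y : N -> R :=
  fun p => 2^-1 * (der X (app1 th Y) p - der Y (app1 th X) p
                   - app1 th (bracket X Y) p).

(* The exterior derivative of a 2-form, up to a nonzero constant factor. *)
Definition dform2 b X Y Z : N -> R :=
  fun p => der X (app2 b Y Z) p + der Y (app2 b Z X) p + der Z (app2 b X Y) p
         - app2 b (bracket X Y) Z p - app2 b (bracket Y Z) X p
         - app2 b (bracket Z X) Y p.

Definition nijenhuis T X Y : vfield R m N :=
  fun p => bracket (appe T X) (appe T Y) p - appe T (bracket (appe T X) Y) p
         - appe T (bracket X (appe T Y)) p + appe T (appe T (bracket X Y)) p.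

(* The Lie derivatives vanish on W when they do so on all smooth fields defined
   on open subsets of W. *)
Definition lie_form1_eq0 W U th : Prop :=
  forall W' X, open W' -> W' `<=` W -> smooth_vfield W' X ->
  forall p, W' p -> der U (app1 th X) p - app1 th (bracket U X) p = 0.

Definition lie_bilin_eq0 W U b : Prop :=
  forall W' X Y, open W' -> W' `<=` W ->
  smooth_vfield W' X -> smooth_vfield W' Y ->
  forall p, W' p ->
    der U (app2 b X Y) p - app2 b (bracket U X) Y p
    - app2 b X (bracket U Y) p = 0.

Definition lie_endo_eq0 W U T : Prop :=
  forall W' X, open W' -> W' `<=` W -> smooth_vfield W' X ->
  forall p, W' p -> bracket U (appe T X) p - appe T (bracket U X) p = 0.

Definition lie_vfield_eq0 W U X : Prop := forall p, W p -> bracket U X p = 0.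

Definition kahler_form (J : endo R m N) (g : bilin R m N) : bilin R m N :=
  fun p u v => g p u (J p v).

Record is_kahler (J : endo R m N) (g : bilin R m N) : Prop := IsKahler {
  kahler_manifold : is_manifold A ;
  kahler_endo : is_endo J ;
  kahler_metric : is_metric g ;
  kahler_complex : forall p u, J p (J p u) = - u ;
  kahler_hermitian : forall p u v, g p (J p u) (J p v) = g p u v ;
  kahler_integrable : forall W X Y, open W ->
    smooth_vfield W X -> smooth_vfield W Y ->
    forall p, W p -> nijenhuis J X Y p = 0 ;
  kahler_closed : forall W X Y Z, open W ->
    smooth_vfield W X -> smooth_vfield W Y -> smooth_vfield W Z ->
    forall p, W p -> dform2 (kahler_form J g) X Y Z p = 0 }.

Definition is_potential (w : bilin R m N) (tau : form1 R m N) : Prop :=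
  forall W X Y, open W -> smooth_vfield W X -> smooth_vfield W Y ->
  forall p, W p -> app2 w X Y p = dform1 tau X Y p.

(* At least two of the three conditions; they then all hold. *)
Definition kahler_automorphism (J : endo R m N) (g : bilin R m N)
    (V : vfield R m N) : Prop :=
  let LJ := lie_endo_eq0 setT V J in
  let Lg := lie_bilin_eq0 setT V g in
  let Lw := lie_bilin_eq0 setT V (kahler_form J g) in
  smooth_vfield setT V /\
  [\/ LJ /\ Lg, LJ /\ Lw | Lg /\ Lw].

Definition acm_automorphism_on W (phi : endo R m N) (xi : vfield R m N)
    (eta : form1 R m N) (G : bilin R m N) (U : vfield R m N) : Prop :=
  smooth_vfield W U /\
  [/\ lie_endo_eq0 W U phi, lie_vfield_eq0 W U xi,
      lie_form1_eq0 W U eta & lie_bilin_eq0 W U G].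

End Calculus.

Section SasakianLift.
Context {R : realType} {m : nat} {N : topologicalType}.

(* R x N with the charts id x chart_p: a tangent vector at (t, p) is a row of
   type 'rV[R]_(1 + m), whose blocks are its dt- and its dpi_2-component. *)
Definition prod_atlas (A : atlas R m N) : atlas R (1 + m) (R * N)%type :=
  Atlas (fun z => [set z' | dom A z.2 z'.2])
        (fun z z' => row_mx (z'.1)%:M (chart A z.2 z'.2))
        (fun z y => (lsubmx y ord0 ord0, chart_inv A z.2 (rsubmx y))).

Definition dt (w : 'rV[R]_(1 + m)) : R := lsubmx w ord0 ord0.
Definition dpi2 (w : 'rV[R]_(1 + m)) : 'rV[R]_m := rsubmx w.

Definition lift_xi : vfield R (1 + m) (R * N)%type := fun=> row_mx 1%:M 0.

Definition lift_eta (tau : form1 R m N) : form1 R (1 + m) (R * N)%type :=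
  fun z w => dt w + tau z.2 (dpi2 w).

Definition lift_vect (tau : form1 R m N) (z : R * N) (v : 'rV[R]_m) :
    'rV[R]_(1 + m) :=
  row_mx 0 v - tau z.2 v *: lift_xi z.

Definition lift_vfield (tau : form1 R m N) (X : vfield R m N) :
    vfield R (1 + m) (R * N)%type :=
  fun z => lift_vect tau z (X z.2).

Definition lift_phi (J : endo R m N) (tau : form1 R m N) :
    endo R (1 + m) (R * N)%type :=
  fun z w => lift_vect tau z (J z.2 (dpi2 w)).

Definition lift_metric (g : bilin R m N) (tau : form1 R m N) :
    bilin R (1 + m) (R * N)%type :=
  fun z w w' => lift_eta tau z w * lift_eta tau z w'
              + g z.2 (dpi2 w) (dpi2 w').

Lemma dpi2_lift (tau : form1 R m N) z v : dpi2 (lift_vect tau z v) = v.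
Proof.
by rewrite /dpi2 /lift_vect linearB linearZ /= !row_mxKr scaler0 subr0.
Qed.

(* The two identities that determine [lift_phi]. *)
Lemma lift_phi_lift (J : endo R m N) (tau : form1 R m N) (X : vfield R m N) :
  appe (lift_phi J tau) (lift_vfield tau X) = lift_vfield tau (appe J X).
Proof. by apply/funext => z; rewrite /appe /lift_phi /lift_vfield dpi2_lift. Qed.

Lemma lift_phi_xi (J : endo R m N) (tau : form1 R m N) z :
  linear (J z.2) -> scalar (tau z.2) -> lift_phi J tau z (lift_xi z) = 0.
Proof.
move=> linJ lint; rewrite /lift_phi /dpi2 row_mxKr /lift_vect.
have J0 : J z.2 0 = 0 by have := linJ (-1) 0 0; rewrite !scaler0 !addr0 scaleN1r addNr.
have t0 : tau z.2 0 = 0.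
  by have := lint (-1) 0 0; rewrite !scaler0 !addr0 mulN1r addNr.
by rewrite J0 t0 scale0r subr0 row_mx0.
Qed.

End SasakianLift.

(* Main.v *)
(* Let [om] be the Kahler form.  On the lift [d eta] is the pullback of [om], so [V^L + f xi]
   preserves [eta] as soon as [df = - 2 om(V, .)].  Since [L_V om = 0] and
   [d om = 0], the form [om(V, .)] is closed, and the Poincare lemma in a chart
   provides [f] locally on [N].  The remaining structure tensors follow: each
   Lie derivative at a point depends only on the values of its arguments there,
   so it can be tested on the coordinate fields of the chart, where it reduces
   to [L_V J = 0] and [L_V g = 0]. *)
Require Import Defs.
From HB Require Import structures.
From mathcomp Require Import all_boot all_order all_algebra.
From mathcomp Require Import all_classical all_reals all_analysis.
From mathcomp Require Import ring.

Set Implicit Arguments.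
Unset Strict Implicit.
Unset Printing Implicit Defensive.

Import Order.TTheory GRing.Theory Num.Theory.
Import numFieldNormedType.Exports.

Local Open Scope classical_set_scope.
Local Open Scope ring_scope.

(** * Differential calculus in row spaces *)

(** The factor [-2] is forced by the convention for the exterior derivative, which contains a factor
    2: since [eta(U) = f], Cartan's formula reads [L_U eta = 2 om(V, .) + df].

    The obstacle is the encoding of tangent vectors. A vector at a point is a row of components in
    the frame of the preferred chart of that very point, and this frame may jump from point to
    point, so fields and tensors can be differentiated only through their expressions in one fixed
    chart. The reduction to coordinate fields therefore rests on a product rule: a contraction is
    written in the chart at z as [L y (H y)], where [H] gives the components of the field and
    [L y w] is the tensor evaluated on the coordinate field with components [w]. By [is_diff_apply]
    the derivative splits into that of the tensor, which sees the field only through its value at z,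
    and that of the field, which cancels against the bracket.

    This argument uses differentiability at z only, so that it applies to [phi X] as soon as a
    differential of [phi X] at z is known. *)

Section RawLinear.
Context {R : realType} {E F : lmodType R} (f : E -> F).
Hypothesis linf : linear f.

Lemma raw_linear0 : f 0 = 0.
Proof. by have := linf (-1) 0 0; rewrite !scaler0 !addr0 scaleN1r addNr. Qed.

Lemma raw_linearN u : f (- u) = - f u.
Proof. by have := linf (-1) u 0; rewrite !scaleN1r raw_linear0 !addr0. Qed.

Lemma raw_linearD u v : f (u + v) = f u + f v.
Proof. by have := linf 1 u v; rewrite !scale1r. Qed.

Lemma raw_linearB u v : f (u - v) = f u - f v.
Proof. by rewrite raw_linearD raw_linearN. Qed.

End RawLinear.

Section Differentials.
Context {R : realType}.
Implicit Types V W : normedModType R.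

(** Chart expressions are meaningful only near a point and junk elsewhere, so every identity between
    them passes to differentials through this locality statement. *)
Lemma near_is_diff V W (f g df : V -> W) (x : V) :
  (\near x, f x = g x) -> is_diff x f df -> is_diff x g df.
Proof.
move=> fg dfx; have fgx : f x = g x by exact: nbhs_singleton fg.
have df_cont := diff_continuous (ex_diff (is_diff_def := dfx)).
have gE : g \o shift x = cst (g x) + 'd f x +o_ 0 id.
  apply/eqaddoP => e e0.
  have /eqaddoP/(_ e e0) := diff_locally (ex_diff (is_diff_def := dfx)).
  have fg0 : \forall h \near (0 : V), f (h + x) = g (h + x).
    by move: fg; rewrite (near_shift 0 x) subr0.
  near_simpl; apply: filterS2 fg0 => h fgh.
  by rewrite !fctE /= fgh fgx.
have dgE : 'd g x = 'd f x :> (V -> W) by exact: diff_unique.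
apply: DiffDef; last by rewrite dgE diff_val.
by apply/diff_locallyP; rewrite dgE; split.
Qed.

Lemma is_diffE V W (f df : V -> W) (x v : V) : is_diff x f df -> 'd f x v = df v.
Proof. by move=> dfx; rewrite diff_val. Qed.

Lemma is_diff_linear V W (L : V -> W) (x : V) :
  linear L -> continuous L -> is_diff x L L.
Proof.
move=> linL contL.
pose LM := GRing.isLinear.Build _ _ _ _ L linL.
pose LL : {linear V -> W} := HB.pack L LM.
have LE : L = LL by [].
rewrite LE; apply: DiffDef; first exact: linear_differentiable.
by rewrite diff_lin.
Qed.

Lemma rV_linearE m W (L : 'rV[R]_m -> W) u : linear L ->
  L u = \sum_i u ord0 i *: L (delta_mx ord0 i).
Proof.
move=> linL.
pose LM := GRing.isLinear.Build _ _ _ _ L linL.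
pose LL : {linear 'rV[R]_m -> W} := HB.pack L LM.
rewrite -[L]/(LL : _ -> _) [u in LHS]row_sum_delta linear_sum.
by apply: eq_bigr => i _; rewrite linearZ.
Qed.

Lemma rV_linear_continuous m W (L : 'rV[R]_m -> W) : linear L -> continuous L.
Proof.
move=> linL; have -> : L = (fun u => \sum_i u ord0 i *: L (delta_mx ord0 i)).
  by apply/funext => u; exact: rV_linearE.
have contL i : continuous (fun u : 'rV[R]_m => u ord0 i *: L (delta_mx ord0 i)).
  by move=> u; apply: continuousZr_tmp; exact: coord_continuous.
elim: (index_enum _) => [|i r IH].
  under eq_fun do rewrite big_nil; exact: cst_continuous.
under eq_fun do rewrite big_cons.
exact: (fun u => continuousD (contL i u) (IH u)).
Qed.

Lemma is_diff_rV_linear m W (L : 'rV[R]_m -> W) x : linear L -> is_diff x L L.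
Proof. by move=> linL; apply: is_diff_linear => //; exact: rV_linear_continuous. Qed.


Lemma scale_is_bilinear W : bilinear_for
    (GRing.Scale.Law.clone _ _ *:%R _) (GRing.Scale.Law.clone _ _ *:%R _)
    ( *:%R : R -> W -> W).
Proof.
split=> [w|h] a x y /=; first by rewrite scalerDl scalerA.
by rewrite scalerDr !scalerA mulrC.
Qed.

HB.instance Definition _ W :=
  bilinear_isBilinear.Build R R W W _ _ _ (@scale_is_bilinear W).

Lemma is_diff_scale V W (h dh : V -> R) (f df : V -> W) (x : V) :
  is_diff x h dh -> is_diff x f df ->
  is_diff x (fun y => h y *: f y) (fun v => h x *: df v + dh v *: f x).
Proof.
move=> dhx dfx.
have cont : continuous (fun p : R * W => p.1 *: p.2) by exact: scale_continuous.
have db : is_diff (h x, f x) (fun p : R * W => p.1 *: p.2)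
    (fun q => h x *: q.2 + q.1 *: f x).
  apply: DiffDef; first exact: (differentiable_bilin (f := *:%R)).
  exact: (diff_bilin (f := *:%R)).
have dp := is_diff_pair dhx dfx.
exact: (is_diff_comp dp db).
Qed.

Lemma is_diff_sum V W I (r : seq I) (f df : I -> V -> W) (x : V) :
  (forall i, is_diff x (f i) (df i)) ->
  is_diff x (fun y => \sum_(i <- r) f i y) (fun v => \sum_(i <- r) df i v).
Proof.
move=> dfx; elim: r => [|i r IH].
  under eq_fun do rewrite big_nil;
    under [X in is_diff_def _ _ X]eq_fun do rewrite big_nil.
  exact: is_diff_cst.
under eq_fun do rewrite big_cons;
  under [X in is_diff_def _ _ X]eq_fun do rewrite big_cons.
exact: is_diffD.
Qed.

(** Expanding [H y] in the standard basis turns [L y (H y)] into a finite sum of products, so it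
    suffices that each partial map [L^~ w] be differentiable. In the applications [L] is a tensor
    contracted with coordinate fields and [H] the components of a field. *)
Lemma is_diff_apply V W m (L : V -> 'rV[R]_m -> W) (H dH : V -> 'rV[R]_m) (x : V)
    (dL : V -> 'rV[R]_m -> W) :
  (\forall y \near x, linear (L y)) ->
  (forall w, is_diff x (L^~ w) (dL^~ w)) -> is_diff x H dH ->
  is_diff x (fun y => L y (H y)) (fun v => dL v (H x) + L x (dH v)).
Proof.
move=> linL dLx dHx.
have linLx := nbhs_singleton linL.
pose e i : 'rV[R]_m := delta_mx ord0 i.
have dH_i i : is_diff x (fun y => H y ord0 i) (fun v => dH v ord0 i).
  have dc : is_diff (H x) (fun u : 'rV[R]_m => u ord0 i) (fun u => u ord0 i).
    by apply: is_diff_rV_linear => a u v; rewrite !mxE.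
  exact: (is_diff_comp dHx dc).
have dS : is_diff x (fun y => \sum_i H y ord0 i *: L y (e i))
    (fun v => \sum_i (H x ord0 i *: dL v (e i) + dH v ord0 i *: L x (e i))).
  by apply: is_diff_sum => i; exact: is_diff_scale.
have linE : \forall y \near x, \sum_i H y ord0 i *: L y (e i) = L y (H y).
  by near do rewrite -rV_linearE//.
(* Linearity of [dL v] is not assumed; it comes from uniqueness of the differential, applied to
   [L^~ (H x)] and to its expansion in the basis. *)
have dLE v : dL v (H x) = \sum_i H x ord0 i *: dL v (e i).
  have d1 := dLx (H x).
  have linE' : \forall y \near x, \sum_i H x ord0 i *: L y (e i) = L y (H x).
    by near do rewrite -rV_linearE//.
  have d2 : is_diff x (fun y => \sum_i H x ord0 i *: L y (e i))
      (fun v => \sum_i H x ord0 i *: dL v (e i)).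
    by apply: is_diff_sum => i; exact: is_diffZ.
  have d3 := near_is_diff linE' d2.
  by have := diff_val (is_diff_def := d1); 
    rewrite (diff_val (is_diff_def := d3)) => /(congr1 (@^~ v)).
have -> : (fun v => dL v (H x) + L x (dH v)) = 
    (fun v => \sum_i (H x ord0 i *: dL v (e i) + dH v ord0 i *: L x (e i))).
  by apply/funext => v; rewrite big_split/= -dLE -rV_linearE.
exact: near_is_diff linE dS.
Unshelve. all: by end_near. Qed.

Lemma is_diff_applyW (V W : normedModType R) m (L : V -> 'rV[R]_m -> W) (H dH : V ->
  'rV[R]_m)
    (x : V) (dL : V -> 'rV[R]_m -> W) :
  (forall y, linear (L y)) ->
  (forall w, is_diff x (L^~ w) (dL^~ w)) -> is_diff x H dH ->
  is_diff x (fun y => L y (H y)) (fun v => dL v (H x) + L x (dH v)).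
Proof.
by move=> linL; apply: is_diff_apply; near do exact: linL.
Unshelve. all: by end_near. Qed.

Lemma is_diff_apply2 (V W : normedModType R) m (L : V -> 'rV[R]_m -> 'rV[R]_m -> W)
    (H dH K dK : V -> 'rV[R]_m) (x : V) (dL : V -> 'rV[R]_m -> 'rV[R]_m -> W) :
  (forall y w, linear (L y w)) -> (forall y w, linear (L y ^~ w)) ->
  (forall w w', is_diff x (fun y => L y w w') (fun v => dL v w w')) ->
  is_diff x H dH -> is_diff x K dK ->
  is_diff x (fun y => L y (H y) (K y))
    (fun v => dL v (H x) (K x) + L x (H x) (dK v) + L x (dH v) (K x)).
Proof.
move=> linr linl dLx dHx dKx.
have d1 w : is_diff x (fun y => L y w (K y)) (fun v => dL v w (K x) + L x w (dK v)).
  exact: (is_diff_applyW (L := fun y => L y w) (dL := fun v => dL v w)).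
exact: (is_diff_applyW (L := fun y w => L y w (K y))
  (dL := fun v w => dL v w (K x) + L x w (dK v))).
Qed.

Lemma is_diff_coord (V : normedModType R) k l (f df : V -> 'M[R]_(k, l)) (x : V) i j :
  is_diff x f df -> is_diff x (fun y => f y i j) (fun v => df v i j).
Proof.
move=> dfx.
have dc : is_diff (f x) (fun u : 'M[R]_(k, l) => u i j) (fun u => u i j).
  by apply: is_diff_linear => [a u v|]; [rewrite !mxE|exact: coord_continuous].
exact: (is_diff_comp dfx dc).
Qed.

End Differentials.

(** * Closure properties of C^k maps *)

Section CkCalculus.
Context {R : realType}.
Implicit Types V W : normedModType R.

Lemma Ck_eq V W k (U : set V) (f g : V -> W) : open U ->
  (forall x, U x -> f x = g x) -> Ck k U f -> Ck k U g.
Proof.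
move=> oU; elim: k f g => [|k IH] f g fg /=.
  move=> cf x Ux; have Unear := open_nbhs_nbhs (conj oU Ux).
  have fgn : {near x, f =1 g} by apply: filterS Unear => y; exact: fg.
  change (g y @[y --> x] --> g x); rewrite -(fg x Ux).
  by apply: cvg_trans (cf x Ux); exact: near_eq_cvg.
case=> df cdf.
have dg x : U x -> is_diff x g ('d f x).
  move=> Ux; have Unear := open_nbhs_nbhs (conj oU Ux).
  apply: near_is_diff (differentiableP (df x Ux)).
  by apply: filterS Unear => y; exact: fg.
split=> [x Ux|v]; first by have := dg x Ux.
apply: IH (cdf v) => x Ux; have := dg x Ux => dgx.
by rewrite [in RHS]diff_val.
Qed.

Lemma CkW V W k (U : set V) (f : V -> W) : Ck k.+1 U f -> Ck k U f.
Proof.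
elim: k f => [|k IH] f [df cdf].
  by move=> x Ux; exact: differentiable_continuous (df x Ux).
by split=> // v; exact: IH (cdf v).
Qed.

Lemma Ck_subset V W k (U U' : set V) (f : V -> W) : U `<=` U' ->
  Ck k U' f -> Ck k U f.
Proof.
move=> UU'; elim: k f => [|k IH] f /=; first by move=> cf x /UU'; exact: cf.
by case=> df cdf; split=> [x /UU'|v]; [exact: df|exact: IH].
Qed.

Lemma Ck_cst V W k (U : set V) (w : W) : Ck k U (cst w).
Proof.
elim: k w => [|k IH] w /=; first by move=> x _; exact: cst_continuous.
split=> [x _|v]; first exact: differentiable_cst.
by under eq_fun do rewrite diff_cst; exact: IH.
Qed.

Lemma CkD V W k (U : set V) (f g : V -> W) : open U -> Ck k U f -> Ck k U g ->
  Ck k U (fun x => f x + g x).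
Proof.
move=> oU; elim: k f g => [|k IH] f g /=.
  by move=> cf cg x Ux; apply: continuousD; [exact: cf|exact: cg].
case=> df cdf [dg cdg]; split=> [x Ux|v].
  by apply: differentiableD; [exact: df|exact: dg].
apply: Ck_eq oU _ (IH _ _ (cdf v) (cdg v)) => x Ux.
by rewrite -[in RHS]/(f + g) diffD//; [exact: df|exact: dg].
Qed.

Lemma Ck_sum V W k (U : set V) I (r : seq I) (f : I -> V -> W) : open U ->
  (forall i, Ck k U (f i)) -> Ck k U (fun x => \sum_(i <- r) f i x).
Proof.
move=> oU cf; elim: r => [|i r IH].
  by under eq_fun do rewrite big_nil; exact: Ck_cst.
by under eq_fun do rewrite big_cons; exact: CkD.
Qed.

Lemma Ck_scale V W k (U : set V) (h : V -> R) (f : V -> W) : open U ->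
  Ck k U h -> Ck k U f -> Ck k U (fun x => h x *: f x).
Proof.
move=> oU; elim: k h f => [|k IH] h f.
  move=> ch cf x Ux; exact: (continuousZ (ch x Ux) (cf x Ux)).
move=> ch cf; have [dh cdh] := ch; have [df cdf] := cf.
have d x : U x -> is_diff x (fun x => h x *: f x)
    (fun v => h x *: 'd f x v + 'd h x v *: f x).
  move=> Ux; exact: is_diff_scale (differentiableP (dh x Ux)) (differentiableP (df x
    Ux)).
split=> [x Ux|v]; first by have := d x Ux.
apply: Ck_eq oU _ (CkD oU (IH _ _ (CkW ch) (cdf v)) (IH _ _ (cdh v) (CkW cf))).
by move=> x Ux /=; have dx := d x Ux; rewrite diff_val.
Qed.

Lemma Ck_linear V W W' k (U : set V) (L : W -> W') (f : V -> W) : open U ->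
  linear L -> continuous L -> Ck k U f -> Ck k U (fun x => L (f x)).
Proof.
move=> oU linL contL; elim: k f => [|k IH] f.
  by move=> cf x Ux; apply: continuous_comp (cf x Ux) _; exact: contL.
case=> df cdf.
have d x : U x -> is_diff x (fun x => L (f x)) (fun v => L ('d f x v)).
  move=> Ux; have dfx := differentiableP (df x Ux).
  exact: (is_diff_comp dfx (is_diff_linear _ linL contL)).
split=> [x Ux|v]; first by have := d x Ux.
by apply: Ck_eq oU _ (IH _ (cdf v)) => x Ux; have dx := d x Ux;
  rewrite [in RHS]diff_val.
Qed.

Lemma Ck_rV_linear V W m k (U : set V) (L : 'rV[R]_m -> W) (f : V -> 'rV[R]_m) :
  open U ->
  linear L -> Ck k U f -> Ck k U (fun x => L (f x)).
Proof. by move=> oU linL; apply: Ck_linear => //; exact: rV_linear_continuous. Qed.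

(** [Ck] tests differentials along fixed vectors only, whereas the chain rule applies ['d g] to the
    moving vector ['d f x v]. Expanding this vector in the basis of the finite-dimensional middle
    space leaves sums of products covered by the induction. *)
Lemma Ck_comp V W m k (U : set V) (U' : set 'rV[R]_m) (f : V -> 'rV[R]_m) (g :
  'rV[R]_m -> W) :
  open U -> (forall x, U x -> U' (f x)) ->
  Ck k U f -> Ck k U' g -> Ck k U (g \o f).
Proof.
move=> oU UU'; elim: k f g UU' => [|k IH] f g UU'.
  by move=> cf cg x Ux; apply: continuous_comp (cf x Ux) (cg _ (UU' x Ux)).
move=> cf [dg cdg]; have [df cdf] := cf.
have d x : U x -> is_diff x (g \o f) ('d g (f x) \o 'd f x).
  move=> Ux; have dfx := differentiableP (df x Ux).
  by apply: (is_diff_comp dfx _); exact: (differentiableP (dg _ (UU' x Ux))).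
split=> [x Ux|v]; first by have := d x Ux.
have cS : Ck k U (fun x => \sum_i 'd f x v ord0 i *: 'd g (f x) (delta_mx ord0 i)).
  apply: Ck_sum => // i; apply: Ck_scale => //.
    have lin_i : linear (fun u : 'rV[R]_m => u ord0 i) by move=> a u w; rewrite !mxE.
    exact: (Ck_rV_linear oU lin_i (cdf v)).
  exact: (IH f (fun y => 'd g y (delta_mx ord0 i)) UU' (CkW cf) (cdg _)).
apply: Ck_eq oU _ cS => x Ux; have dx := d x Ux.
by rewrite [in RHS]diff_val/= [in RHS]rV_linearE//; exact: linearP.
Qed.

Lemma Ck_id V k (U : set V) : Ck k U id.
Proof.
case: k => [|k] /=; first by move=> x _; exact: cvg_id.
split=> // v; under eq_fun do rewrite diff_val; exact: Ck_cst.
Qed.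

End CkCalculus.

(** * Mean value theorem, symmetry of second derivatives, continuous partial derivatives *)

Section MeanValue.
Context {R : realType}.
Implicit Types V W : normedModType R.

Lemma is_diff_is_derive V W (f df : V -> W) (x v : V) :
  is_diff x f df -> is_derive x v f (df v).
Proof.
move=> dfx; have dx := ex_diff (is_diff_def := dfx).
by apply: DeriveDef; [exact: diff_derivable|rewrite deriveE// diff_val].
Qed.

Lemma is_derive_line V W (f : V -> W) (y v : V) (t : R) (d : W) :
  is_derive (y + t *: v) v f d -> is_derive t 1 (fun t => f (y + t *: v)) d.
Proof.
move=> [df <-].
have E : (fun h : R => h^-1 *: (((fun t =>
  f (y + t *: v)) \o shift t) h%:A - f (y + t *: v)))
   = (fun h : R => h^-1 *: ((f \o shift (y + t *: v)) (h *: v) - f (y + t *: v))).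
  apply/funext => h /=; congr (_ *: (f _ - _)).
  by rewrite scalerDl [h%:A]mulr1 addrCA.
by apply: DeriveDef; [rewrite /derivable E|rewrite /derive E].
Qed.

Lemma mean_value_line V (f : V -> R) (y v : V) (D : R -> R) (h : R) : 0 <= h ->
  (forall t, 0 <= t <= h -> is_derive (y + t *: v) v f (D t)) ->
  exists2 t, 0 <= t <= h & f (y + h *: v) - f y = h * D t.
Proof.
move=> h0 df.
have dl t : 0 <= t <= h -> is_derive t 1 (fun t => f (y + t *: v)) (D t).
  by move=> /df; exact: is_derive_line.
have [||c] := @MVT_segment R (fun t => f (y + t *: v)) D 0 h h0.
- by move=> t; rewrite in_itv/= => /andP[/ltW t0 /ltW th]; apply: dl; rewrite t0.
- apply: derivable_within_continuous => t; rewrite in_itv/= => /dl dt.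
  exact: ex_derive.
rewrite in_itv/= scale0r addr0 subr0 => ch ->; exists c => //.
by rewrite mulrC.
Qed.

(* The second difference is computed by the mean value theorem in either order. *)
Lemma mixed_difference V (U : set V) (f : V -> R) (x u w : V) (h : R) :
  Ck 2 U f -> 0 <= h ->
  (forall a b, 0 <= a <= h -> 0 <= b <= h -> U (x + a *: u + b *: w)) ->
  exists a b, [/\ 0 <= a <= h, 0 <= b <= h &
    f (x + h *: u + h *: w) - f (x + h *: u) - (f (x + h *: w) - f x) =
    h * (h * 'd (fun y => 'd f y u) (x + a *: u + b *: w) w)].
Proof.
move=> [df cdf] h0 Uab.
have [ddf _] := cdf u.
have hh : 0 <= h <= h by rewrite h0 lexx.
have [|a ah E1] := @mean_value_line V (fun y => f (y + h *: w) - f y) x u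
  (fun t => 'd f (x + t *: u + h *: w) u - 'd f (x + t *: u) u) h h0.
  move=> t th.
  have U1 := Uab t h th hh; have U2 := Uab t 0 th _.
  have d2 : is_derive (x + t *: u) u f ('d f (x + t *: u) u).
    apply: is_diff_is_derive; apply: differentiableP; apply: df.
    by have := U2; rewrite scale0r addr0; apply; rewrite lexx.
  have d1 : is_derive (x + t *: u) u (fun y =>
    f (y + h *: w)) ('d f (x + t *: u + h *: w) u).
    apply: is_diff_is_derive.
    have ds : is_diff (x + t *: u) (fun y => y + h *: w) id.
      have := is_diffD (is_diff_id (x + t *: u)) (is_diff_cst (h *: w) (x + t *: u)).
      by move=> /is_diff_eq; apply; apply/funext => v; rewrite !fctE addr0.
    exact: (is_diff_comp ds (differentiableP (df _ U1))).
  exact: is_deriveB.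
have [|b bh E2] := @mean_value_line V (fun y => 'd f y u) (x + a *: u) w
  (fun t => 'd (fun y => 'd f y u) (x + a *: u + t *: w) w) h h0.
  move=> t th; apply: is_diff_is_derive; apply: differentiableP; apply: ddf.
  exact: Uab.
by exists a, b; split=> //; rewrite E1 E2.
Qed.

Lemma near_ball V (x : V) (P : set V) : nbhs x P ->
  exists2 r : R, 0 < r & forall y, `|y - x| < r -> P y.
Proof.
move=> /nbhs_ballP[r /= r0 rP]; exists r => // y yx; apply: rP.
by rewrite -ball_normE /= distrC.
Qed.

(** The second difference over a small parallelogram is symmetric in [u] and [w], and it equals
    [h ^ 2] times either mixed derivative at some nearby point. The two mixed derivatives thus share
    a value near [x], and continuity makes them agree at [x] up to any [e]. *)
Lemma second_diff_sym V (U : set V) (f : V -> R) (x u w : V) : open U -> U x ->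
  Ck 2 U f -> 'd (fun y => 'd f y u) x w = 'd (fun y => 'd f y w) x u.
Proof.
move=> oU Ux C2.
have cont u' w' : {for x, continuous (fun y => 'd (fun y => 'd f y u') y w')}.
  by have [_ /(_ u')[_ /(_ w')]] := C2; apply.
apply/eqP; rewrite -subr_eq0 -normr_le0; apply/ler_addgt0Pl => e e0.
rewrite addr0.
have e20 : 0 < e / 2 by rewrite divr_gt0.
have n1 : \forall y \near x, `|'d (fun y => 'd f y u) x w - 'd (fun y =>
  'd f y u) y w| < e / 2.
  by have /cvgrPdist_lt/(_ _ e20) := cont u w.
have n2 : \forall y \near x, `|'d (fun y => 'd f y w) x u - 'd (fun y =>
  'd f y w) y u| < e / 2.
  by have /cvgrPdist_lt/(_ _ e20) := cont w u.
have n3 : nbhs x U by exact: open_nbhs_nbhs.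
have [r r0 rP] := near_ball (filterI n3 (filterI n1 n2)).
(* The parallelogram with sides [h u] and [h w] must stay inside the ball of radius [r]: the [1]
   keeps the denominator positive, the [2] makes the inclusion strict. *)
pose h := r / (2 * (`|u| + `|w| + 1)).
have s0 : 0 < `|u| + `|w| + 1 by rewrite ltr_wpDl// addr_ge0.
have h0 : 0 < h by rewrite divr_gt0// mulr_gt0.
have in_ball a b : 0 <= a <= h -> 0 <= b <= h -> `|x + a *: u + b *: w - x| < r.
  move=> /andP[a0 ah] /andP[b0 bh]; rewrite -(addrA x) [x + _]addrC addrK.
  apply: (le_lt_trans (ler_normD _ _)); rewrite !normrZ !ger0_norm//.
  apply: (@le_lt_trans _ _ (h * (`|u| + `|w| + 1))).
    rewrite mulrDr mulr1 mulrDr; apply: ler_wpDr; first exact: ltW.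
    by apply: lerD; rewrite ler_wpM2r.
  by rewrite /h invfM mulrA divfK ?gt_eqF// gtr_pMr// invf_lt1// ltr1n.
have [|a1 [b1 [a1h b1h E1]]] := @mixed_difference V U f x u w h C2 (ltW h0).
  by move=> a b ah bh; have [] := rP _ (in_ball a b ah bh).
have [|a2 [b2 [a2h b2h E2]]] := @mixed_difference V U f x w u h C2 (ltW h0).
  by move=> a b ah bh; rewrite addrAC; have [] := rP _ (in_ball b a bh ah).
have E : 'd (fun y => 'd f y u) (x + a1 *: u + b1 *: w) w =
    'd (fun y => 'd f y w) (x + a2 *: w + b2 *: u) u.
  have hn0 : h != 0 by rewrite gt_eqF.
  apply: (mulfI hn0); apply: (mulfI hn0); rewrite -E1 -E2.
  by rewrite [x + h *: w + _]addrAC; ring.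
have [_ [l1 _]] := rP _ (in_ball a1 b1 a1h b1h).
have [_ [_ l2]] := rP _ (in_ball b2 a2 b2h a2h).
rewrite addrAC in l2; rewrite E in l1.
set A := 'd _ x w in l1 *; set B := 'd _ x u in l2 *; set C := 'd _ _ u in l1 l2.
have -> : A - B = (A - C) - (B - C) by ring.
apply: (le_trans (ler_normB _ _)); rewrite [leRHS]splitr.
by apply: lerD; exact: ltW.
Qed.

Lemma second_diff_sym_rV (V : normedModType R) n (U : set V) (f : V -> 'rV[R]_n)
    (x u w : V) : open U -> U x -> Ck 2 U f ->
  'd (fun y => 'd f y u) x w = 'd (fun y => 'd f y w) x u.
Proof.
move=> oU Ux C2; have [df cdf] := C2.
apply/rowP => i.
have lini : linear (fun u : 'rV[R]_n => u ord0 i) by move=> a v v'; rewrite !mxE.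
have C2i : Ck 2 U (fun y => f y ord0 i) by exact: (Ck_rV_linear oU lini C2).
have dfi y v : U y -> 'd (fun y => f y ord0 i) y v = 'd f y v ord0 i.
  by move=> Uy; rewrite (diff_val (is_diff_def := is_diff_coord ord0 i
    (differentiableP (df y Uy)))).
have ddi v v' : 'd (fun y => 'd f y v) x v' ord0 i = 'd (fun y => 'd (fun y =>
  f y ord0 i) y v) x v'.
  have [dd _] := cdf v.
  have d1 := is_diff_coord ord0 i (differentiableP (dd x Ux)).
  have d2 : is_diff x (fun y => 'd (fun y => f y ord0 i) y v) (fun v' =>
    'd (fun y => 'd f y v) x v' ord0 i).
    apply: near_is_diff d1.
    by apply: filterS (open_nbhs_nbhs (conj oU Ux)) => y Uy; rewrite dfi.
  by rewrite (diff_val (is_diff_def := d2)).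
by rewrite !ddi (second_diff_sym _ _ oU Ux C2i).
Qed.

Lemma norm_coord_le m (u : 'rV[R]_m) i : `|u ord0 i| <= `|u|.
Proof. by rewrite [leRHS]/Num.Def.normr/= mx_normrE;
  exact: (le_bigmax _ _ (ord0, i)). Qed.

Lemma rV_linear_bound m (L : 'rV[R]_m -> R) (K : R) u : linear L ->
  (forall i, `|L (delta_mx ord0 i)| <= K) -> `|L u| <= m%:R * (`|u| * K).
Proof.
move=> linL LK; rewrite rV_linearE//.
apply: (le_trans (ler_norm_sum _ _ _)).
rewrite mulr_natl -[X in _ <= _ *+ X]card_ord -sumr_const.
apply: ler_sum => i _; rewrite normrZ.
by apply: ler_pM => //; exact: norm_coord_le.
Qed.

Lemma is_diff_littleo V W (f df : V -> W) (x : V) : linear df -> continuous df ->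
  (forall e, 0 < e -> \forall h \near (0 : V), `|f (h + x) - f x - df h| <= e * `|h|) ->
  is_diff x f df.
Proof.
move=> lindf contdf bound.
pose dfM := GRing.isLinear.Build _ _ _ _ df lindf.
pose dfL : {linear V -> W} := HB.pack df dfM.
have E : f \o shift x = cst (f x) + df +o_ 0 id.
  apply/eqaddoP => e e0; near_simpl.
  by apply: filterS (bound e e0) => h; rewrite !fctE /= opprD addrA.
have dE : 'd f x = df :> (_ -> _) by exact: (@diff_unique _ _ _ _ dfL).
apply: DiffDef => //.
by apply/diff_locallyP; rewrite dE; split.
Qed.

(** By the mean value theorem on the segment, [f (c + h) - f c = al (c + t h) h] for some [t];
    continuity makes [al (c + t h) - al c] small on the basis vectors, hence small as a linear
    form. *)
Lemma is_diff_partials m (f : 'rV[R]_m -> R) (al : 'rV[R]_m -> 'rV[R]_m -> R) c :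
  (\forall y \near c, linear (al y)) ->
  (\forall y \near c, forall h, is_derive y h f (al y h)) ->
  (forall w, {for c, continuous (al^~ w)}) -> is_diff c f (al c).
Proof.
move=> linal dal contal.
have linc := nbhs_singleton linal.
apply: is_diff_littleo => // [|e e0]; first exact: rV_linear_continuous.
(* [rV_linear_bound] costs a factor [m]; the successor avoids dividing by 0 when [m = 0]. *)
have e'0 : 0 < e / m.+1%:R by rewrite divr_gt0.
have n1 : \forall y \near c, forall i, `|al c (delta_mx ord0 i) - al y (delta_mx
  ord0 i)| <= e / m.+1%:R.
  apply: (@filter_forall 'rV[R]_m 'I_m (fun i y =>
    `|al c (delta_mx ord0 i) - al y (delta_mx ord0 i)| <= e / m.+1%:R)
    (nbhs c) (nbhs_filter c)) => i.
  by have /cvgrPdist_le/(_ _ e'0) := contal (delta_mx ord0 i).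
have [r r0 rP] := near_ball (filterI linal (filterI dal n1)).
have n0 : \forall h \near (0 : 'rV[R]_m), `|h| < r.
  apply/nbhs_ballP; exists r => // h.
  by rewrite -ball_normE /= sub0r normrN.
apply: filterS n0 => h hr.
have inb t : 0 <= t <= 1 -> `|c + t *: h - c| < r.
  move=> /andP[t0 t1]; rewrite addrC addKr normrZ ger0_norm//.
  by apply: le_lt_trans hr; rewrite ler_piMl.
have [|t t01] := @mean_value_line _ f c h (fun t => al (c + t *: h) h) 1 ler01.
  by move=> t /inb/rP[_ []].
rewrite scale1r mul1r => Ef.
rewrite [h + c]addrC Ef.
have [lint [_ nt]] := rP _ (inb t t01).
have lind : linear (fun w => al (c + t *: h) w - al c w).
  by move=> a u v; rewrite lint linc scalerBr opprD addrACA.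
apply: (le_trans (rV_linear_bound (K := e / m.+1%:R) _ lind _)).
  by move=> i; rewrite distrC.
rewrite mulrCA [leRHS]mulrC ler_wpM2l//.
by rewrite mulrCA ger_pMr// ler_pdivrMr// mul1r ler_nat.
Qed.

End MeanValue.

(** * The Poincare lemma for closed 1-forms on a ball *)

Section Poincare.
Context {R : realType} {m : nat}.

Lemma near_bounded (V : normedModType R) (x : V) (I : finType) (f : I -> V -> R) :
  (forall i, {for x, continuous (f i)}) ->
  exists2 K : R, 0 <= K & \forall y \near x, forall i, `|f i y| <= K.
Proof.
move=> cf.
exists (\sum_i (`|f i x| + 1)); first by apply: sumr_ge0 => i _; rewrite addr_ge0.
have near1 i : \forall y \near x, `|f i x - f i y| <= 1.
  by have /cvgrPdist_le/(_ _ ltr01) := cf i.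
have := @filter_forall V I (fun i y =>
  `|f i x - f i y| <= 1) (nbhs x) (nbhs_filter x) near1.
apply: filterS => y fy i.
rewrite (bigD1 i)//=; apply: ler_wpDr; first by apply: sumr_ge0 => j _;
  rewrite addr_ge0.
rewrite -(subKr (f i x) (f i y)).
by apply: (le_trans (ler_normB _ _)); rewrite lerD2l.
Qed.

Let mu := (@lebesgue_measure R).

Lemma is_diff_segment (V : normedModType R) (c u : V) (t : R) :
  is_diff t (fun t => c + t *: u) (fun s => s *: u).
Proof.
have := is_diffD (is_diff_cst c t) (is_diff_scalel t u).
by move=> /is_diff_eq; apply; apply/funext => s; rewrite !fctE add0r.
Qed.

Variables (U : set 'rV[R]_m) (c : 'rV[R]_m) (al : 'rV[R]_m -> 'rV[R]_m -> R).
Hypothesis oU : open U.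
Hypothesis Uc : U c.
Hypothesis linal : forall y, U y -> linear (al y).
Hypothesis C1al : forall w, Ck 1 U (al^~ w).
Hypothesis closed_al : forall y v w, U y -> 'd (al^~ w) y v = 'd (al^~ v) y w.

Let d_al y w : U y -> is_diff y (al^~ w) ('d (al^~ w) y).
Proof. by move=> Uy; have [dw _] := C1al w; exact: differentiableP (dw _ Uy). Qed.

(** Closedness moves [w] into the argument of a differential, where linearity is automatic. *)
Let al_linear_diff y v : U y -> linear (fun w => 'd (al^~ w) y v).
Proof.
by move=> Uy a w w'; rewrite !(closed_al v)// linearP.
Qed.

(* The primitive is [\int_0^1 al (c + t (y - c)) (y - c) dt]; closedness turns
   its derivative along [h] into the integral of d/dt [t al (c + t (y - c)) h]. *)
Lemma poincare : exists (F : 'rV[R]_m -> R) (r : R),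
  [/\ 0 < r, ball c r `<=` U & forall y, ball c r y -> is_diff y F (al y)].
Proof.
pose e i : 'rV[R]_m := delta_mx ord0 i.
(* The bounds [K] on the coefficients of [al] and [K'] on their partial derivatives supply the
   constant dominating function for differentiation under the integral; [r] is chosen so that both
   hold on the ball. *)
have [K K0 nK] : exists2 K : R, 0 <= K &
    \forall y \near c, forall i, `|al y (e i)| <= K.
  apply: (@near_bounded 'rV[R]_m c 'I_m (fun i => al^~ (e i))) => i.
  exact: differentiable_continuous (ex_diff (is_diff_def := d_al (e i) Uc)).
have [K' K'0 nK'] : exists2 K : R, 0 <= K &
    \forall y \near c, forall ij, `|'d (al^~ (e ij.1)) y (e ij.2)| <= K.
  apply: (@near_bounded 'rV[R]_m c ('I_m * 'I_m)%type (fun ij y =>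
    'd (al^~ (e ij.1)) y (e ij.2))) => ij.
  by have [_ /(_ (e ij.2))] := C1al (e ij.1); apply.
have [r r0 rP] := near_ball (filterI (open_nbhs_nbhs (conj oU Uc)) (filterI nK nK')).
pose B := [set y : 'rV[R]_m | `|y - c| < r].
have BU y : B y -> U y by move=> /rP[].
have seg y t : B y -> 0 <= t <= 1 -> B (c + t *: (y - c)).
  move=> By /andP[t0 t1]; rewrite /B/= [c + _]addrC addrK normrZ ger0_norm//.
  by apply: le_lt_trans By; rewrite ler_piMl.
pose g y t := al (c + t *: (y - c)) (y - c).
pose F y := (\int[mu]_(t in `[0%R, 1%R]) g y t)%R.
(* This is the derivative of the integrand when [y] moves along [h]: the base point moves with
   velocity [t h], the argument with velocity [h]. *)
pose D y h t := 'd (al^~ (y - c)) (c + t *: (y - c)) (t *: h) + al (c + t *: (y - c)) h.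
have dg y h s t : B (y + s *: h) -> 0 <= t <= 1 ->
    is_derive s 1 (fun s => g (y + s *: h) t) (D (y + s *: h) h t).
  move=> By t01; have Bp := seg _ _ By t01.
  have Up := BU _ Bp.
  have dH : is_diff s (fun s => y + s *: h - c) (fun s => s *: h).
    have := is_diffB (is_diff_segment y h s) (is_diff_cst c s).
    by move=> /is_diff_eq; apply; apply/funext => a; rewrite !fctE subr0.
  have dp : is_diff s (fun s => c + t *: (y + s *: h - c)) (fun s => t *: (s *: h)).
    have := is_diffD (is_diff_cst c s) (is_diffZ t dH).
    by move=> /is_diff_eq; apply; apply/funext => a; rewrite !fctE add0r.
  have linp : \forall s' \near s, linear (al (c + t *: (y + s' *: h - c))).
    have cont := differentiable_continuous (ex_diff (is_diff_def := dp)).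
    have nU : \forall s' \near s, U (c + t *: (y + s' *: h - c)).
      exact: (cont U (open_nbhs_nbhs (conj oU Up))).
    by apply: filterS nU => s'; exact: linal.
  have dL w : is_diff s (fun s => al (c + t *: (y + s *: h - c)) w)
      (fun s' => 'd (al^~ w) (c + t *: (y + s *: h - c)) (t *: (s' *: h))).
    exact: (is_diff_comp dp (d_al w Up)).
  have := is_diff_is_derive (1 : R) (is_diff_apply linp dL dH).
  by rewrite scale1r.
have Dbound y h t : B y -> 0 <= t <= 1 ->
    `|D y h t| <= m%:R * (r * (m%:R * (`|h| * K'))) + m%:R * (`|h| * K).
  move=> By t01; have Bp := seg _ _ By t01.
  have [Up [Kp K'p]] := rP _ Bp.
  have /andP[t0 t1] := t01.
  apply: (le_trans (ler_normD _ _)); apply: lerD; last first.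
    by apply: rV_linear_bound => //; exact: linal.
  apply: (@le_trans _ _ (m%:R * (`|y - c| * (m%:R * (`|h| * K'))))); last first.
    by rewrite ler_wpM2l// ler_wpM2r ?mulr_ge0// ltW.
  apply: (rV_linear_bound (L := fun w => 'd (al^~ w) _ (t *: h))).
    exact: al_linear_diff.
  move=> i; apply: (@le_trans _ _ (m%:R * (`|t *: h| * K'))); last first.
    rewrite ler_wpM2l// ler_wpM2r// normrZ ger0_norm//.
    by rewrite ler_piMl.
  by apply: rV_linear_bound; [exact: linearP|move=> j; exact: (K'p (i, j))].
have dsegal y w (t : R) : B y -> 0 <= t <= 1 ->
    is_diff t (fun t => al (c + t *: (y - c)) w)
      (fun s => 'd (al^~ w) (c + t *: (y - c)) (s *: (y - c))).
  move=> By t01; have Up := BU _ (seg _ _ By t01).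
  exact: (is_diff_comp (is_diff_segment c (y - c) t) (d_al w Up)).
have intg y : B y -> mu.-integrable `[0%R, 1%R] (EFin \o g y).
  move=> By; apply: continuous_compact_integrable; first exact: segment_compact.
  apply: continuous_in_subspaceT => t; rewrite inE/= in_itv/= => t01.
  exact: differentiable_continuous (ex_diff (is_diff_def := dsegal y (y - c) t By t01)).
have intD y h : B y -> (\int[mu]_(t in `[0%R, 1%R]) D y h t)%R = al y h.
  move=> By.
  pose P t := t * al (c + t *: (y - c)) h.
  have dP (t : R) : 0 <= t <= 1 -> is_derive t 1 P (D y h t).
    move=> t01; have Up := BU _ (seg _ _ By t01).
    have := is_diff_is_derive (1 : R) (is_diff_scale (is_diff_id t) (dsegal y h t By
      t01)).
    by rewrite /D closed_al// linearZ/= !scale1r.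
  have contP (t : R) : 0 <= t <= 1 -> {for t, continuous P}.
    move=> /dP dPt; apply: differentiable_continuous.
    by apply/derivable1_diffP; exact: ex_derive.
  rewrite /Rintegral (@continuous_FTC2 _ (D y h) P 0 1)//.
  - by rewrite -EFinB /= /P mul0r mul1r scale1r subr0 [c + _]addrC subrK.
  - apply: continuous_in_subspaceT => t; rewrite inE/= in_itv/= => t01.
    have Up := BU _ (seg _ _ By t01).
    have -> : D y h = (fun t => t * 'd (al^~ (y - c)) (c + t *: (y - c)) h +
        al (c + t *: (y - c)) h).
      by apply/funext => s; rewrite /D linearZ.
    have cseg : {for t, continuous (fun t : R => c + t *: (y - c))}.
      exact: differentiable_continuous (ex_diff (is_diff_def := is_diff_segment c (y
        - c) t)).
    have [_ /(_ h)/(_ _ Up) c1] := C1al (y - c).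
    have c1' : {for t, continuous (fun t : R =>
      'd (al^~ (y - c)) (c + t *: (y - c)) h)}.
      exact: (continuous_comp cseg c1).
    have c2 : {for t, continuous (fun t : R => al (c + t *: (y - c)) h)}.
      exact: differentiable_continuous (ex_diff (is_diff_def := dsegal y h t By t01)).
    have c0 : {for t, continuous (@idfun R)} by exact: cvg_id.
    exact: (continuousD (continuousM c0 c1') c2).
  - split.
    + move=> t; rewrite in_itv/= => /andP[/ltW t0 /ltW t1].
      have dPt : is_derive t 1 P (D y h t) by apply: dP; rewrite t0.
      exact: ex_derive.
    + by apply: cvg_at_right_filter; apply: contP; rewrite lexx ler01.
    + by apply: cvg_at_left_filter; apply: contP; rewrite lexx ler01.
  - move=> t; rewrite in_itv/= => /andP[/ltW t0 /ltW t1].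
    have dPt : is_derive t 1 P (D y h t) by apply: dP; rewrite t0.
    by rewrite derive1E derive_val.
have dF y h : B y -> is_derive y h F (al y h).
  move=> By.
  (* For [|s| < d] the point [y + s h] stays in the ball; the [1] covers [h = 0]. *)
  pose d := (r - `|y - c|) / (`|h| + 1).
  have h1 : 0 < `|h| + 1 by rewrite ltr_wpDl.
  have d0 : 0 < d by rewrite divr_gt0// subr_gt0.
  have Bs s : `](- d), d[%classic s -> B (y + s *: h).
    rewrite /= in_itv/= -ltr_norml => sd.
    rewrite /B/= addrAC (le_lt_trans (ler_normD _ _))// -ltrBrDl normrZ.
    apply: (@le_lt_trans _ _ (`|s| * (`|h| + 1))); first by rewrite ler_wpM2l// lerDl.
    by rewrite -ltr_pdivlMr.
  have Id0 : `](- d), d[%classic (0 : R) by rewrite /= in_itv/= oppr_lt0 d0.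
  have mI : measurable (`[0%R, 1%R]%classic : set (measurableTypeR R))
    by exact: measurable_itv.
  have t01 (t : R) : `[0%R, 1%R]%classic t -> 0 <= t <= 1 by rewrite /= in_itv.
  pose G : R -> R := cst (m%:R * (r * (m%:R * (`|h| * K'))) + m%:R * (`|h| * K)).
  have G0 t : 0 <= G t by rewrite /G/= addr_ge0 ?mulr_ge0// ltW.
  have iG : mu.-integrable `[0%R, 1%R] (EFin \o G).
    apply: continuous_compact_integrable; first exact: segment_compact.
    by apply: continuous_subspaceT; exact: cst_continuous.
  have intf s : `](- d), d[%classic s -> mu.-integrable `[0%R, 1%R] (EFin \o g (y +
    s *: h)).
    by move=> /Bs; exact: intg.
  have derf s t : `](- d), d[%classic s -> `[0%R, 1%R]%classic t ->
      derivable ((fun s => g (y + s *: h))^~ t) s 1.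
    move=> /Bs sB /t01 t1; have ds := dg y h s t sB t1.
    exact: ex_derive.
  have d1E s t : `](- d), d[%classic s -> `[0%R, 1%R]%classic t ->
      partial1of2 (fun s => g (y + s *: h)) s t = D (y + s *: h) h t.
    move=> /Bs sB /t01 t1; have ds := dg y h s t sB t1.
    by rewrite partial1of2E derive_val.
  have ubf s t : `](- d), d[%classic s -> `[0%R, 1%R]%classic t ->
      `|partial1of2 (fun s => g (y + s *: h)) s t| <= G t.
    by move=> sd tt; rewrite d1E//; apply: Dbound; [exact: Bs|exact: t01].
  have der0 := derivable_under_integral mI Id0 intf derf G0 iG ubf.
  have val0 := differentiation_under_integral mI Id0 intf derf G0 iG ubf.
  have {}val0 : 'D_1 (fun s : R => F (y + s *: h)) 0 = al y h.
    rewrite -derive1E; rewrite val0 -(intD y h By); apply: eq_Rintegral => t tt.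
    by rewrite d1E ?scale0r ?addr0//; rewrite inE in tt.
  have E : (fun s : R => s^-1 *: (((fun s : R =>
    F (y + s *: h)) \o shift 0) s%:A - F (y + 0 *: h)))
      = (fun s : R => s^-1 *: ((F \o shift y) (s *: h) - F y)).
    apply/funext => s /=; rewrite scale0r !addr0 [s%:A]mulr1.
    by rewrite [s *: h + y]addrC.
  apply: DeriveDef; first by rewrite /derivable -E.
  by rewrite /derive -E.
have ballE : ball c r = B.
  by apply/seteqP; split=> z; rewrite -ball_normE /B/= distrC.
exists F, r; rewrite ballE; split=> // y By.
have Bopen : \forall z \near y, B z.
  have oB : open B by rewrite -ballE; exact: ball_open.
  exact: (open_nbhs_nbhs (conj oB By)).
(* So far only directional derivatives of [F] are known; their continuity in the base point upgrades
   them to a differential. *)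
apply: is_diff_partials.
- by apply: filterS Bopen => z /BU; exact: linal.
- by apply: filterS Bopen => z Bz h; exact: dF.
- move=> w; have Uy := BU _ By.
  exact: differentiable_continuous (ex_diff (is_diff_def := d_al w Uy)).
Qed.

End Poincare.

(** * Charts and coordinate fields *)

(* The part of [is_manifold] needed below, so that it can be shown for
   [prod_atlas] without discussing the topology of the product. *)
Record smooth_atlas (R : realType) (m : nat) (N : topologicalType)
    (A : atlas R m N) : Prop := SmoothAtlas {
  sa_dom_open : forall p, open (dom A p) ;
  sa_dom_center : forall p, dom A p p ;
  sa_chart_open : forall p, open (chart A p @` dom A p) ;
  sa_chartK : forall p x, dom A p x -> chart_inv A p (chart A p x) = x ;
  sa_chart_continuous : forall p x, dom A p x -> {for x, continuous (chart A p)} ;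
  sa_chart_inv_continuous : forall p y, (chart A p @` dom A p) y ->
    {for y, continuous (chart_inv A p)} ;
  sa_compatible : forall p q,
    smooth_on (chart A p @` (dom A p `&` dom A q)) (chart A q \o chart_inv A p) }.

Lemma manifold_smooth_atlas (R : realType) (m : nat) (N : topologicalType)
  (A : atlas R m N) : is_manifold A -> smooth_atlas A.
Proof. by case. Qed.

Section Charts.
Context {R : realType} {m : nat} {N : topologicalType} {A : atlas R m N}.
Hypothesis SA : smooth_atlas A.
Implicit Types (p q r x : N) (W : set N) (X Y : vfield R m N).

(** The Jacobian at [x] of the change of coordinates from the chart at [p] to the chart at [q]. With
    [q = x] it converts components in the chart at [p] into a tangent vector at [x]. *)
Definition dtrans (A : atlas R m N) p q x : 'rV[R]_m -> 'rV[R]_m :=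
  'd (chart A q \o chart_inv A p) (chart A p x).

(* The field with constant components [w] in the chart at [p]; junk outside
   [dom A p]. *)
Definition coord_field (A : atlas R m N) p (w : 'rV[R]_m) : vfield R m N :=
  fun q => dtrans A p q q w.

Lemma dtrans_linear p q x : linear (dtrans A p q x).
Proof. by move=> a u v; rewrite /dtrans linearP. Qed.

Lemma chart_imP p W y : (chart A p @` (W `&` dom A p)) y <->
  [/\ dom A p (chart_inv A p y), chart A p (chart_inv A p y) = y & W (chart_inv A p y)].
Proof.
split=> [[x [Wx px] <-]|[py Ey Wy]]; first by rewrite sa_chartK.
by exists (chart_inv A p y).
Qed.

Lemma open_chart_im p W : open W -> open (chart A p @` (W `&` dom A p)).
Proof.
move=> oW; rewrite openE => y /chart_imP[py Ey Wy].
have imy : (chart A p @` dom A p) y by exists (chart_inv A p y).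
have n1 := open_nbhs_nbhs (conj (sa_chart_open SA (p := p)) imy).
have n2 : \forall z \near y, W (chart_inv A p z).
  exact: (sa_chart_inv_continuous SA imy (open_nbhs_nbhs (conj oW Wy))).
apply: filterS2 n1 n2 => z [x px <-] Wx.
by apply/chart_imP; rewrite sa_chartK// in Wx *.
Qed.

(** Passes from neighbourhoods in the manifold to neighbourhoods in coordinates, keeping the facts
    that make [chart_inv] a genuine inverse there. *)
Lemma near_chart p q (P : N -> Prop) : dom A p q -> (\forall x \near q, P x) ->
  \forall y \near chart A p q, [/\ dom A p (chart_inv A p y),
    chart A p (chart_inv A p y) = y & P (chart_inv A p y)].
Proof.
move=> pq nP.
have imq : (chart A p @` dom A p) (chart A p q) by exists q.
have n1 := open_nbhs_nbhs (conj (sa_chart_open SA (p := p)) imq).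
have n2 : \forall y \near chart A p q, P (chart_inv A p y).
  by apply: (sa_chart_inv_continuous SA imq); rewrite sa_chartK.
by apply: filterS2 n1 n2 => z [x px <-]; rewrite sa_chartK.
Qed.

Lemma chart_im_center p W q : dom A p q -> W q -> (chart A p @` (W `&` dom A p))
  (chart A p q).
Proof. by exists q. Qed.

Lemma transE p q x : dom A p x -> (chart A q \o chart_inv A p) (chart A p x) = chart
  A q x.
Proof. by move=> px; rewrite /comp sa_chartK. Qed.

Lemma trans_Ck k p q : Ck k (chart A p @` (dom A q `&` dom A p)) (chart A q \o
  chart_inv A p).
Proof. by rewrite setIC; exact: sa_compatible. Qed.

Lemma trans_is_diff p q x : dom A p x -> dom A q x ->
  is_diff (chart A p x) (chart A q \o chart_inv A p) (dtrans A p q x).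
Proof.
move=> px qx; have [d _] := trans_Ck 1 p q.
by apply: differentiableP; apply: d; exact: chart_im_center.
Qed.

(** The cocycle rule for Jacobians: the chain rule, combined with the fact that the transition maps
    compose correctly near [x]. *)
Lemma dtransK p q r x w : dom A p x -> dom A q x -> dom A r x ->
  dtrans A q r x (dtrans A p q x w) = dtrans A p r x w.
Proof.
move=> px qx rx.
have d1 := trans_is_diff px qx.
have d2 : is_diff ((chart A q \o chart_inv A p) (chart A p x)) (chart A r \o
  chart_inv A q) (dtrans A q r x).
  by rewrite (transE q px); exact: (trans_is_diff qx rx).
have d3 := is_diff_comp d1 d2.
have nq : \forall y \near x, dom A q y
  by exact: (open_nbhs_nbhs (conj (sa_dom_open SA q) qx)).
have d4 : is_diff (chart A p x) (chart A r \o chart_inv A p) (dtrans A q r x \o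
  dtrans A p q x).
  apply: near_is_diff d3; apply: filterS (near_chart px nq) => y [py Ey qy] /=.
  by rewrite sa_chartK.
have := diff_val (is_diff_def := d4); rewrite -/(dtrans A p r x).
by move=> /(congr1 (@^~ w)).
Qed.

Lemma dtrans_id p x w : dom A p x -> dtrans A p p x w = w.
Proof.
move=> px.
have d : is_diff (chart A p x) (chart A p \o chart_inv A p) id.
  apply: near_is_diff (is_diff_id _).
  have nT : \forall y \near x, True by exact: filterT.
  by apply: filterS (near_chart px nT) => y [].
by have := diff_val (is_diff_def := d); rewrite -/(dtrans A p p x) => /(congr1 (@^~ w)).
Qed.

Lemma coord_field_linear p q a u v :
  coord_field A p (a *: u + v) q = a *: coord_field A p u q + coord_field A p v q.
Proof. exact: dtrans_linear. Qed.

Lemma coord_field_center p w : coord_field A p w p = w.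
Proof. by rewrite /coord_field dtrans_id//; exact: sa_dom_center. Qed.

Lemma dtrans_coord_field p q w : dom A p q -> dtrans A q p q (coord_field A p w q) = w.
Proof.
move=> pq; have qq := sa_dom_center SA q.
by rewrite /coord_field (dtransK w pq qq pq) (dtrans_id w pq).
Qed.

Lemma in_chartE p X q : dom A p q -> in_chart A p X (chart A p q) = dtrans A q p q
  (X q).
Proof. by move=> pq; rewrite /in_chart sa_chartK. Qed.

Lemma in_chart_center p X : in_chart A p X (chart A p p) = X p.
Proof. by have pp := sa_dom_center SA p; rewrite in_chartE// dtrans_id. Qed.

Lemma in_chart_coord_field p q x w : dom A p x -> dom A q x ->
  in_chart A q (coord_field A p w) (chart A q x) = dtrans A p q x w.
Proof.
move=> px qx; have xx := sa_dom_center SA x.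
by rewrite in_chartE// /coord_field dtransK.
Qed.

(** In the chart at [q] the components are the derivative along [w] of the transition map from [p]
    to [q], precomposed with the reverse transition map. *)
Lemma coord_field_smooth p w : smooth_vfield A (dom A p) (coord_field A p w).
Proof.
move=> q k; have [_ /(_ w) C] := trans_Ck k.+1 p q.
have oI := open_chart_im (p := q) (sa_dom_open SA p).
have C' : Ck k (chart A q @` (dom A p `&` dom A q))
    ((fun y => 'd (chart A q \o chart_inv A p) y w) \o (chart A p \o chart_inv A q)).
  apply: Ck_comp C => //; last exact: trans_Ck.
  by move=> _ [x [px qx] <-] /=; rewrite sa_chartK//; exact: chart_im_center.
apply: Ck_eq oI _ C' => _ [x [px qx] <-] /=.
by rewrite (in_chart_coord_field w px qx) /dtrans (sa_chartK SA qx).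
Qed.

Lemma smooth_vfield_sub W W' X : W' `<=` W -> smooth_vfield A W X -> smooth_vfield A
  W' X.
Proof.
move=> W'W sX p k; apply: Ck_subset (sX p k) => _ [x [W'x px] <-].
by exists x => //; split=> //; exact: W'W.
Qed.

Lemma smooth_fun_sub W W' f : W' `<=` W -> smooth_fun A W f -> smooth_fun A W' f.
Proof.
move=> W'W sf p k; apply: Ck_subset (sf p k) => _ [x [W'x px] <-].
by exists x => //; split=> //; exact: W'W.
Qed.

Lemma smooth_vfield_is_diff W X p q : smooth_vfield A W X -> W q -> dom A p q ->
  is_diff (chart A p q) (in_chart A p X) ('d (in_chart A p X) (chart A p q)).
Proof.
move=> sX Wq pq; have [d _] := sX p 1%N.
by apply: differentiableP; apply: d; exact: chart_im_center.
Qed.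

Lemma smooth_fun_is_diff W f p q : smooth_fun A W f -> W q -> dom A p q ->
  is_diff (chart A p q) (f \o chart_inv A p) ('d (f \o chart_inv A p) (chart A p q)).
Proof.
move=> sf Wq pq; have [d _] := sf p 1%N.
by apply: differentiableP; apply: d; exact: chart_im_center.
Qed.

(** [der] is computed in the preferred chart of the point itself; by the chain rule any chart around
    the point gives the same value, so one chart can serve a whole neighbourhood. *)
Lemma der_chart X f p q df : dom A p q ->
  is_diff (chart A p q) (f \o chart_inv A p) df ->
  der A X f q = df (in_chart A p X (chart A p q)).
Proof.
move=> pq dfq; have qq := sa_dom_center SA q.
have d1 := trans_is_diff qq pq.
have d2 : is_diff ((chart A p \o chart_inv A q) (chart A q q)) (f \o chart_inv A p) df.
  by rewrite (transE p qq).
have d3 : is_diff (chart A q q) (f \o chart_inv A q) (df \o dtrans A q p q).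
  apply: near_is_diff (is_diff_comp d1 d2).
  have np : \forall y \near q, dom A p y
    by exact: (open_nbhs_nbhs (conj (sa_dom_open SA p) pq)).
  by apply: filterS (near_chart qq np) => y [_ _ py] /=; rewrite sa_chartK.
by rewrite /der (diff_val (is_diff_def := d3)) /= in_chartE.
Qed.

(** In the chart at [q] the coordinate field has constant components near [q], so only the
    derivative of [X] survives in the bracket. *)
Lemma bracket_coord_field_center X q w :
  bracket A X (coord_field A q w) q = - 'd (in_chart A q X) (chart A q q) w.
Proof.
have qq := sa_dom_center SA q.
rewrite /bracket coord_field_center.
have d : is_diff (chart A q q) (in_chart A q (coord_field A q w)) (cst 0).
  apply: near_is_diff (is_diff_cst w (chart A q q)).
  have nT : \forall y \near q, True by exact: filterT.
  apply: filterS (near_chart qq nT) => y [qy Ey _].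
  by rewrite -Ey (in_chart_coord_field _ qy qy) (dtrans_id _ qy).
exact: etrans (congr1 (fun a => a - 'd (in_chart A q X) (chart A q q) w) (is_diffE
  (X q) d)) (sub0r _).
Qed.

Lemma coord_field_dtrans p q w : dom A p q -> coord_field A p (dtrans A q p q w) q = w.
Proof.
move=> pq; have qq := sa_dom_center SA q.
by rewrite /coord_field (dtransK w qq pq qq) (dtrans_id w qq).
Qed.

(** The bracket is computed in the chart at [q], where coordinate fields of [p] are no longer
    constant: their components are first derivatives of the transition map, and the bracket vanishes
    by symmetry of its second derivatives. *)
Lemma bracket_coord_field p q u w : dom A p q ->
  bracket A (coord_field A p u) (coord_field A p w) q = 0.
Proof.
move=> pq; have qq := sa_dom_center SA q.
pose T := chart A q \o chart_inv A p.
have oI := open_chart_im (p := p) (sa_dom_open SA q).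
have Iq : (chart A p @` (dom A q `&` dom A p)) (chart A p q) by exact: chart_im_center.
have d v v' : 'd (in_chart A q (coord_field A p v)) (chart A q q) (coord_field A p v' q)
   = 'd (fun z => 'd T z v) (chart A p q) v'.
  have [_ /(_ v)[dT _]] := trans_Ck 2 p q.
  have d1 := trans_is_diff qq pq.
  have d2 : is_diff ((chart A p \o chart_inv A q) (chart A q q)) (fun z => 'd T z v)
      ('d (fun z => 'd T z v) (chart A p q)).
    by rewrite (transE p qq); apply: differentiableP; exact: (dT _ Iq).
  have d3 : is_diff (chart A q q) (in_chart A q (coord_field A p v))
      ('d (fun z => 'd T z v) (chart A p q) \o dtrans A q p q).
    apply: near_is_diff (is_diff_comp d1 d2).
    have np : \forall y \near q, dom A p y
      by exact: (open_nbhs_nbhs (conj (sa_dom_open SA p) pq)).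
    apply: filterS (near_chart qq np) => y [qy Ey py] /=.
    by rewrite -[in RHS]Ey in_chart_coord_field.
  apply: etrans (is_diffE _ d3) _.
  exact: (congr1 ('d (fun z => 'd T z v) (chart A p q)) (dtrans_coord_field v' pq)).
have E := second_diff_sym_rV w u oI Iq (trans_Ck 2 p q).
exact: etrans (congr2 (fun a b => a - b) (etrans (d w u) E) (d u w)) (subrr _).
Qed.

End Charts.

(** * Automorphisms of the Kahler structure *)

Section Kahler.
Context {R : realType} {m : nat} {N : topologicalType} {A : atlas R m N}.
Context {J : endo R m N} {g : bilin R m N}.
Hypothesis hK : is_kahler A J g.
Implicit Types (p q : N) (W : set N) (X Y V : vfield R m N).

Let SA : smooth_atlas A := manifold_smooth_atlas (kahler_manifold hK).
Let om := kahler_form J g.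

Let Jlin p : linear (J p). Proof. by case: (kahler_endo hK). Qed.
Let glin p u : linear (g p u). Proof. by case: (kahler_metric hK) => glin _ _ _;
  exact: glin. Qed.
Let gsym p u v : g p u v = g p v u. Proof. by case: (kahler_metric hK). Qed.

Lemma kahler_form_linear p u : linear (om p u).
Proof. by move=> a v w; rewrite /om /kahler_form Jlin glin. Qed.

Lemma kahler_form_anti p u v : om p u v = - om p v u.
Proof.
rewrite /om /kahler_form -(kahler_hermitian hK p u) (kahler_complex hK).
by rewrite (raw_linearN (glin _ _)) gsym.
Qed.

Lemma kahler_form_smooth W X Y : open W -> smooth_vfield A W X -> smooth_vfield A W Y ->
  smooth_fun A W (app2 om X Y).
Proof.
move=> oW sX sY; have [_ _ _ smg] := kahler_metric hK; have [_ smJ] := kahler_endo hK.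
exact: (smg W X (appe J Y) oW sX (smJ W Y oW sY)).
Qed.

Lemma derN W X f p : smooth_fun A W f -> W p ->
  der A X (fun q => - f q) p = - der A X f p.
Proof.
move=> sf Wp; have d := smooth_fun_is_diff sf Wp (sa_dom_center SA p).
exact: (is_diffE (X p) (is_diffN d)).
Qed.

Lemma bracketC X Y p : bracket A X Y p = - bracket A Y X p.
Proof. by rewrite /bracket opprB. Qed.

Section Automorphism.
Context {V : vfield R m N}.
Hypothesis hV : kahler_automorphism A J g V.

Let sV W : smooth_vfield A W V.
Proof. by have [sV _] := hV; apply: smooth_vfield_sub sV. Qed.

(** Given [L_V J = 0], the conditions on [g] and [om] follow from each other by replacing [Y] with
    [J Y], because [om(X, Y) = g(X, J Y)] and [om(X, J Y) = - g(X, Y)]. The remaining case uses that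
    [g] is definite. *)
Lemma automorphism_lie : [/\ lie_endo_eq0 A setT V J, lie_bilin_eq0 A setT V g &
  lie_bilin_eq0 A setT V om].
Proof.
have [_ smJ] := kahler_endo hK; have [_ _ gpos smg] := kahler_metric hK.
have [_ [[LJ Lg]|[LJ Lw]|[Lg Lw]]] := hV.
- split=> // W X Y oW WT sX sY p Wp.
  have Eg := Lg W X (appe J Y) oW WT sX (smJ _ _ oW sY) p Wp.
  have EJ := LJ W Y oW WT sY p Wp; move/subr0_eq : EJ => EJ.
  by move: Eg; rewrite [X in _ - X]/app2 EJ.
- split=> // W X Y oW WT sX sY p Wp.
  have sJY := smJ _ _ oW sY.
  have Ew := Lw W X (appe J Y) oW WT sX sJY p Wp.
  have EJ := LJ W Y oW WT sY p Wp; move/subr0_eq : EJ => EJ.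
  have omJ Z1 Z2 : app2 om Z1 (appe J Z2) = (fun q => - app2 g Z1 Z2 q).
    apply/funext => q; rewrite /app2 /om /kahler_form /appe (kahler_complex hK).
    exact: raw_linearN.
  have E3 : app2 om X (bracket A V (appe J Y)) p = - app2 g X (bracket A V Y) p.
    rewrite /app2 EJ /om /kahler_form /appe (kahler_complex hK).
    exact: raw_linearN.
  move: Ew; rewrite -/om E3 !omJ (derN _ (smg _ _ _ oW sX sY) Wp).
  by move=> E; apply: oppr_inj; rewrite oppr0 -[RHS]E; ring.
- split=> // W X oW WT sX p Wp.
  (* Subtracting the two Lie derivative identities gives [g(Y, u) = 0] at [p] for any local field
     [Y]; the coordinate field with value [u] at [p] then yields [g(u, u) = 0], against
     positivity. *)
  set u := _ - _; apply/eqP; apply: contraT => un0.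
  pose W' := W `&` dom A p.
  have oW' : open W' by apply: openI => //; exact: sa_dom_open.
  have sX' : smooth_vfield A W' X by apply: smooth_vfield_sub sX => q [].
  have sY : smooth_vfield A W' (coord_field A p u).
    by apply: smooth_vfield_sub (coord_field_smooth SA p u) => q [].
  have W'p : W' p by split=> //; exact: sa_dom_center.
  have W'T : W' `<=` setT by [].
  have Ew := Lw W' _ X oW' W'T sY sX' p W'p.
  have Eg := Lg W' _ (appe J X) oW' W'T sY (smJ _ _ oW' sX') p W'p.
  have E0 : g p u u = 0.
    rewrite {2}/u (raw_linearB (glin _ _)).
    move: Ew Eg; rewrite /app2 (coord_field_center SA) /om /kahler_form /appe.
    move=> Ew Eg; apply: etrans (etrans (congr2 (fun a b => a - b) Ew Eg) (subrr 0)).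
    by ring.
  by have := gpos p u un0; rewrite E0 ltxx.
Qed.

(* This is [d om(V, X, Y) - (L_V om)(X, Y) = 0], i.e. Cartan's formula. *)
Lemma contraction_closed W X Y p : open W -> W p -> smooth_vfield A W X ->
  smooth_vfield A W Y -> bracket A X Y p = 0 ->
  der A X (app2 om V Y) p = der A Y (app2 om V X) p.
Proof.
move=> oW Wp sX sY XY0.
have [_ _ Lw] := automorphism_lie.
have Ew := Lw W X Y oW (@subsetT _ _) sX sY p Wp.
have Ed := kahler_closed hK oW (sV W) sX sY Wp.
have E1 : app2 om Y V = (fun q => - app2 om V Y q).
  by apply/funext => q; exact: kahler_form_anti.
have E2 : app2 om (bracket A X Y) V p = 0.
  by rewrite /app2 XY0 kahler_form_anti (raw_linear0 (@kahler_form_linear _ _)) oppr0.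
have E3 : app2 om (bracket A Y V) X p = app2 om X (bracket A V Y) p.
  rewrite /app2 kahler_form_anti bracketC.
  by rewrite (raw_linearN (@kahler_form_linear _ _)) opprK.
move: Ed; rewrite /dform2 -/om E1 E2 E3 (derN _ (kahler_form_smooth oW (sV W) sY) Wp).
move=> Ed; apply/esym/eqP; rewrite -subr_eq0; apply/eqP.
by apply: etrans (etrans (congr2 (fun a b => a - b) Ed Ew) (subrr 0)); ring.
Qed.

Lemma local_primitive p : exists (W : set N) (f : N -> R),
  [/\ open W, W p, smooth_fun A W f &
      forall q, W q -> is_diff (chart A q q) (f \o chart_inv A q) (fun w =>
        - 2 * om q (V q) w)].
Proof.
(* The form [- 2 om(V, .)] in the coordinates of the chart at [p]. Its closedness is
   [contraction_closed] on coordinate fields, whose brackets vanish. *)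
pose al y w := - 2 * app2 om V (coord_field A p w) (chart_inv A p y).
pose U := chart A p @` (dom A p `&` dom A p).
have pp := sa_dom_center SA p.
have oU : open U by exact: (open_chart_im SA (p := p) (sa_dom_open SA p)).
have Up : U (chart A p p) by exact: chart_im_center.
have sc w : smooth_vfield A (dom A p) (coord_field A p w) by exact: coord_field_smooth.
have smooth_al w k : Ck k U (al^~ w).
  have C := kahler_form_smooth (sa_dom_open SA p) (sV _) (sc w) p k.
  exact: (Ck_scale oU (Ck_cst k U (- 2 : R)) C).
have linal y : linear (al y).
  move=> a u v; rewrite /al /app2 (coord_field_linear) kahler_form_linear mulrDr.
  by rewrite -[in LHS]/(a * _) mulrCA.
have dal q w v : dom A p q -> 'd (al^~ w) (chart A p q) v =
    - 2 * der A (coord_field A p v) (app2 om V (coord_field A p w)) q.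
  move=> pq; have d := smooth_fun_is_diff (kahler_form_smooth (sa_dom_open SA p) (sV
    _) (sc w)) pq pq.
  rewrite (der_chart SA _ pq d) (in_chart_coord_field SA _ pq pq) (dtrans_id SA _ pq).
  exact: (is_diffE v (is_diffZ (- 2) d)).
have closed y v w : U y -> 'd (al^~ w) y v = 'd (al^~ v) y w.
  move=> [q [pq _] <-]; rewrite !dal//; congr (_ * _).
  by apply: (contraction_closed (sa_dom_open SA p)) => //;
    exact: (bracket_coord_field SA).
have [F [r [r0 rU dF]]] := poincare oU Up (fun y _ => linal y) (fun w =>
  smooth_al w 1%N) closed.
pose B := ball (chart A p p) r.
(* No induction is necessary: the derivatives of [F] are the smooth coefficients of [al]. *)
have smF k : Ck k B F.
  case: k => [y By|k]; first exact: differentiable_continuous (ex_diff (is_diff_def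
    := dF y By)).
  split=> [y By|w]; first exact: (ex_diff (is_diff_def := dF y By)).
  apply: (Ck_eq _ _ (Ck_subset rU (smooth_al w k))); first exact: ball_open.
  by move=> y By; rewrite (is_diffE w (dF y By)).
pose W := [set q | dom A p q /\ B (chart A p q)].
have oW : open W.
  rewrite openE => q [pq Bq].
  have oB : open B by exact: ball_open.
  have n1 := open_nbhs_nbhs (conj (sa_dom_open SA p) pq).
  have n2 := sa_chart_continuous SA pq (open_nbhs_nbhs (conj oB Bq)).
  exact: filterS2 n1 n2 => x px Bx; split.
exists W, (F \o chart A p); split=> //.
- by split=> //; exact: ballxx.
- move=> q k.
  have oI := open_chart_im SA (p := q) oW.
  have cT : Ck k (chart A q @` (W `&` dom A q)) (chart A p \o chart_inv A q).
    apply: Ck_subset (trans_Ck SA k q p) => _ [x [[px _] qx] <-].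
    by exists x.
  apply: (Ck_comp oI _ cT (smF k)) => _ [x [[px Bx] qx] <-].
  by rewrite (transE SA p qx).
- move=> q [pq Bq]; have qq := sa_dom_center SA q.
  have d1 := trans_is_diff SA qq pq.
  have d2 : is_diff ((chart A p \o chart_inv A q) (chart A q q)) F (al (chart A p q)).
    by rewrite (transE SA p qq); exact: dF.
  have d3 := is_diff_comp d1 d2.
  (* The primitive was built in the chart at [p], but its differential is wanted in the chart at
     [q]; the Jacobian from the chain rule is undone by the one hidden in [coord_field]. *)
  suff E : al (chart A p q) \o dtrans A q p q = (fun w => - 2 * om q (V q) w).
    by rewrite -E.
  apply/funext => w; rewrite /comp /al /app2 (sa_chartK SA pq).
  by rewrite /coord_field (dtransK SA w qq pq qq) (dtrans_id SA w qq).
Qed.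

End Automorphism.

(** This is [2 dtau(V, .) = 2 om(V, .)] on a coordinate field, with the bracket term written out in
    the chart at [q]: the combination that arises when [eta] is differentiated along the lifted
    field. *)
Lemma potential_diff (tau : form1 R m N) V q w : is_form1 A tau -> is_potential A om
  tau ->
  smooth_vfield A setT V ->
  'd (app1 tau (coord_field A q w) \o chart_inv A q) (chart A q q) (V q)
  - 'd (app1 tau V \o chart_inv A q) (chart A q q) w
  + tau q ('d (in_chart A q V) (chart A q q) w) = 2 * om q (V q) w.
Proof.
move=> [lint smt] hpot sV.
have qq := sa_dom_center SA q.
have sV' : smooth_vfield A (dom A q) V by apply: smooth_vfield_sub sV.
have := hpot (dom A q) V (coord_field A q w) (sa_dom_open SA q) sV'
  (coord_field_smooth SA q w) q qq.
rewrite /dform1 /app2 /der (coord_field_center SA) => ->.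
have -> : app1 tau (bracket A V (coord_field A q w)) q =
    - tau q ('d (in_chart A q V) (chart A q q) w).
  by rewrite /app1 (bracket_coord_field_center SA) (raw_linearN (lint q)).
rewrite opprK.
by rewrite mulrA mulfV ?mul1r// pnatr_eq0.
Qed.

End Kahler.

(** * The Sasakian lift *)

Section RowBlocks.
Context {R : realType} {m : nat}.
Implicit Types (V : normedModType R) (a : R) (b : 'rV[R]_m) (w : 'rV[R]_(1 + m)).

Lemma dt_row a b : dt (row_mx a%:M b) = a.
Proof. by rewrite /dt row_mxKl mxE eqxx mulr1n. Qed.

Lemma dpi2_row a b : dpi2 (row_mx a%:M b : 'rV[R]_(1 + m)) = b.
Proof. by rewrite /dpi2 row_mxKr. Qed.

Lemma row_dt_dpi2 w : row_mx (dt w)%:M (dpi2 w) = w.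
Proof. by rewrite /dt -mx11_scalar hsubmxK. Qed.

(** In this form, differentiability, smoothness and continuity of block rows follow from the rules
    for scaling and for linear maps. *)
Lemma row_scalarE a b :
  row_mx a%:M b = a *: row_mx 1%:M 0 + row_mx 0 b :> 'rV[R]_(1 + m).
Proof. by rewrite scale_row_mx scaler0 add_row_mx addr0 add0r scalemx1. Qed.

Lemma row_scalar0 : row_mx 0%:M 0 = 0 :> 'rV[R]_(1 + m).
Proof. by rewrite row_scalarE scale0r add0r row_mx0. Qed.

Lemma dt_linear : linear (@dt R m).
Proof. by move=> a u v; rewrite /dt linearP !mxE. Qed.

Lemma dpi2_linear : linear (@dpi2 R m).
Proof. by move=> a u v; rewrite /dpi2 linearP. Qed.

Lemma row0_linear : linear (fun b => row_mx 0 b : 'rV[R]_(1 + m)).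
Proof. by move=> a u v; rewrite scale_row_mx add_row_mx scaler0 addr0. Qed.

Lemma is_diff_row V (f df : V -> R) (h dh : V -> 'rV[R]_m) (x : V) :
  is_diff x f df -> is_diff x h dh ->
  is_diff x (fun y => row_mx (f y)%:M (h y) : 'rV[R]_(1 + m))
    (fun v => row_mx (df v)%:M (dh v)).
Proof.
move=> dfx dhx.
have d1 := is_diff_scale dfx (is_diff_cst (row_mx 1%:M 0 : 'rV[R]_(1 + m)) x).
have d2 := is_diff_comp dhx (is_diff_rV_linear (h x) row0_linear).
have := is_diffD d1 d2.
rewrite (_ : _ + _ = (fun y => row_mx (f y)%:M (h y))); last first.
  by apply/funext => y; rewrite row_scalarE.
move=> /is_diff_eq; apply; apply/funext => v.
by rewrite [in RHS]row_scalarE !fctE scaler0 add0r.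
Qed.

Lemma Ck_row V k (U : set V) (f : V -> R) (h : V -> 'rV[R]_m) : open U ->
  Ck k U f -> Ck k U h -> Ck k U (fun y => row_mx (f y)%:M (h y) : 'rV[R]_(1 + m)).
Proof.
move=> oU cf ch.
have C1 := Ck_scale oU cf (Ck_cst k U (row_mx 1%:M 0 : 'rV[R]_(1 + m))).
have C2 := Ck_rV_linear oU row0_linear ch.
apply: Ck_eq oU _ (CkD oU C1 C2) => y Uy.
by rewrite [in RHS]row_scalarE.
Qed.

Lemma continuous_row (T : topologicalType) (f : T -> R) (h : T -> 'rV[R]_m) (x : T) :
  {for x, continuous f} -> {for x, continuous h} ->
  {for x, continuous (fun y => row_mx (f y)%:M (h y) : 'rV[R]_(1 + m))}.
Proof.
move=> cf ch.
have c1 : {for x, continuous (fun y => f y *: (row_mx 1%:M 0 : 'rV[R]_(1 + m)))}.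
  exact: continuousZr_tmp.
have c2 : {for x, continuous (fun y => row_mx 0 (h y) : 'rV[R]_(1 + m))}.
  exact: (continuous_comp ch (rV_linear_continuous row0_linear (x := h x))).
have := continuousD c1 c2.
by rewrite (_ : _ + _ = (fun y => row_mx (f y)%:M (h y)))//; apply/funext => y;
  rewrite row_scalarE.
Qed.

Lemma dpi2_continuous : continuous (@dpi2 R m).
Proof. exact: (rV_linear_continuous dpi2_linear). Qed.

Lemma dt_continuous : continuous (@dt R m).
Proof. exact: (rV_linear_continuous dt_linear). Qed.

Lemma is_diff_dpi2 V (h dh : 'rV[R]_m -> V) w :
  is_diff (dpi2 w) h dh -> is_diff w (fun y => h (dpi2 y)) (fun v => dh (dpi2 v)).
Proof. by move=> dhx; exact: (is_diff_comp (is_diff_rV_linear w dpi2_linear) dhx). Qed.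

End RowBlocks.

(** * Charts of the product of the line with [N] *)

Section ProductCharts.
Context {R : realType} {m : nat} {N : topologicalType} {A : atlas R m N}.
Hypothesis SA : smooth_atlas A.
Local Notation PA := (prod_atlas A).
Implicit Types (z : (R * N)%type) (X : vfield R (1 + m) (R * N)%type).

Lemma open_snd (W : set N) : open W -> open [set z : R * N | W z.2].
Proof. by move=> oW; apply: (open_comp _ oW) => z _; exact: cvg_snd. Qed.

(** Open sets of the form [R x W] are enough throughout: their chart images are preimages under
    [dpi2], so openness and smoothness are inherited from [N]. *)
Lemma prod_chart_im z (W : set N) y :
  (chart PA z @` ([set z' | W z'.2] `&` dom PA z)) y <->
  (chart A z.2 @` (W `&` dom A z.2)) (dpi2 y).
Proof.
split=> [[z' [Wz' zz'] <-]|[q [Wq zq] Eq]].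
  by exists z'.2 => //=; rewrite dpi2_row.
by exists (dt y, q); rewrite //= Eq row_dt_dpi2.
Qed.

Lemma open_prod_chart_im z (W : set N) : open W ->
  open (chart PA z @` ([set z' | W z'.2] `&` dom PA z)).
Proof.
move=> oW; have oI := open_chart_im SA (p := z.2) oW.
have -> : chart PA z @` ([set z' | W z'.2] `&` dom PA z) =
    @dpi2 R m @^-1` (chart A z.2 @` (W `&` dom A z.2)).
  by apply/seteqP; split=> y /prod_chart_im.
by apply: (open_comp _ oI) => y _; exact: dpi2_continuous.
Qed.

Lemma prod_smooth_atlas : smooth_atlas PA.
Proof.
split.
- by move=> z; apply: open_snd; exact: (sa_dom_open SA z.2).
- by move=> z; exact: (sa_dom_center SA z.2).
- move=> z; have := open_prod_chart_im (z := z) (@openT N).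
  by congr open; congr (_ @` _); apply/seteqP; split=> [z' []|z' zz'] //.
- move=> z z' zz'; rewrite /= -/(dt _) -/(dpi2 _) dt_row dpi2_row (sa_chartK SA zz').
  by case: z' zz'.
- move=> z z' zz'; apply: continuous_row; first exact: cvg_fst.
  exact: (continuous_comp cvg_snd (sa_chart_continuous SA zz')).
- move=> z y [z' zz' <-].
  have im : (chart A z.2 @` dom A z.2) (dpi2 (chart PA z z')).
    by exists z'.2 => //=; rewrite dpi2_row.
  have c1 := dt_continuous (x := chart PA z z').
  have c2 := continuous_comp (dpi2_continuous (x := chart PA z z'))
    (sa_chart_inv_continuous SA im).
  exact: (cvg_pair c1 c2).
- move=> z z' k.
  have -> : dom PA z `&` dom PA z' = [set x | dom A z'.2 x.2] `&` dom PA z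
    by rewrite setIC.
  have oI := open_prod_chart_im (z := z) (sa_dom_open SA z'.2).
  apply: (Ck_row (f := @dt R m) (h := (chart A z'.2 \o chart_inv A z.2) \o @dpi2 R
    m)) => //.
    exact: (Ck_rV_linear oI dt_linear (Ck_id k _)).
  apply: (Ck_comp oI _ (Ck_rV_linear oI dpi2_linear (Ck_id k _)) (trans_Ck SA k z.2
    z'.2)).
  by move=> y /prod_chart_im.
Qed.

(** Transition maps of the product are the identity times a transition map of [N], so their
    Jacobians are block diagonal. *)
Lemma prod_dtrans z z' x w : dom A z.2 x.2 -> dom A z'.2 x.2 ->
  dtrans PA z z' x w = row_mx (dt w)%:M (dtrans A z.2 z'.2 x.2 (dpi2 w)).
Proof.
move=> zx z'x.
have E : dpi2 (chart PA z x) = chart A z.2 x.2 by rewrite /= dpi2_row.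
have d1 : is_diff (dpi2 (chart PA z x)) (chart A z'.2 \o chart_inv A z.2) (dtrans A
  z.2 z'.2 x.2).
  by rewrite E; exact: (trans_is_diff SA).
have d2 := is_diff_row (is_diff_rV_linear (chart PA z x) dt_linear) (is_diff_dpi2 d1).
exact: (is_diffE w d2).
Qed.

Lemma prod_in_chart z X z' : dom A z.2 z'.2 ->
  in_chart PA z X (chart PA z z') =
  row_mx (dt (X z'))%:M (dtrans A z'.2 z.2 z'.2 (dpi2 (X z'))).
Proof.
move=> zz'; rewrite (in_chartE prod_smooth_atlas)//.
by rewrite prod_dtrans//; exact: sa_dom_center.
Qed.

(** [P] takes both the point and its coordinates because the identities to be checked mix tensors
    given on points with components given in coordinates. *)
Lemma near_prod_chart z (P : (R * N)%type -> 'rV[R]_(1 + m) -> Prop) :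
  (forall z', dom A z.2 z'.2 -> P z' (chart PA z z')) ->
  \forall y \near chart PA z z, P (chart_inv PA z y) y.
Proof.
move=> HP; have nT : \forall x \near z, True by exact: filterT.
apply: filterS (near_chart prod_smooth_atlas (sa_dom_center prod_smooth_atlas z) nT).
by move=> y [zy Ey _]; rewrite -[X in P _ X]Ey; exact: HP.
Qed.

Lemma dpi2_chart z z' : dpi2 (chart PA z z') = chart A z.2 z'.2.
Proof. by rewrite /= dpi2_row. Qed.

Lemma smooth_fun_snd (W : set N) (f : N -> R) : open W -> smooth_fun A W f ->
  smooth_fun PA [set z | W z.2] (f \o snd).
Proof.
move=> oW sf z k; have oI := open_prod_chart_im (z := z) oW.
apply: (Ck_comp (g := f \o chart_inv A z.2) oI _ (Ck_rV_linear oI dpi2_linear (Ck_id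
  k _)) (sf z.2 k)).
by move=> y /prod_chart_im.
Qed.

Lemma smooth_vfield_row (W : set N) (u : N -> R) (V : vfield R m N) : open W ->
  smooth_fun A W u -> smooth_vfield A W V ->
  smooth_vfield PA [set z | W z.2] (fun z => row_mx (u z.2)%:M (V z.2)).
Proof.
move=> oW su sV z k; have oI := open_prod_chart_im (z := z) oW.
have C1 := smooth_fun_snd oW su z k.
have C2 : Ck k (chart PA z @` ([set z | W z.2] `&` dom PA z)) (in_chart A z.2 V \o
  @dpi2 R m).
  apply: (Ck_comp oI _ (Ck_rV_linear oI dpi2_linear (Ck_id k _)) (sV z.2 k)).
  by move=> y /prod_chart_im.
apply: Ck_eq oI _ (Ck_row oI C1 C2) => _ [z' [Wz' zz'] <-].
rewrite prod_in_chart// dt_row dpi2_row -(in_chartE SA)//.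
by rewrite /comp dpi2_chart (sa_chartK prod_smooth_atlas zz').
Qed.

End ProductCharts.

(** * The Sasakian structure tensors in product charts *)

Section Lift.
Context {R : realType} {m : nat} {N : topologicalType} {A : atlas R m N}.
Context {J : endo R m N} {g : bilin R m N} {tau : form1 R m N} {V : vfield R m N}.
Hypothesis hK : is_kahler A J g.
Hypothesis htau : is_form1 A tau.
Hypothesis hpot : is_potential A (kahler_form J g) tau.
Hypothesis hV : kahler_automorphism A J g V.
Local Notation PA := (prod_atlas A).
Let SA : smooth_atlas A := manifold_smooth_atlas (kahler_manifold hK).
Let SPA : smooth_atlas PA := prod_smooth_atlas SA.
Let om := kahler_form J g.
Let eta := lift_eta tau.
Let cf := coord_field A.

Let Jlin p : linear (J p). Proof. by case: (kahler_endo hK). Qed.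
Let glin p u : linear (g p u). Proof. by case: (kahler_metric hK) => glin _ _ _;
  exact: glin. Qed.
Let gsym p u v : g p u v = g p v u. Proof. by case: (kahler_metric hK). Qed.
Let tlin p : linear (tau p). Proof. by case: htau. Qed.
Let sV : smooth_vfield A setT V. Proof. by case: hV. Qed.
Let scf p w : smooth_vfield A (dom A p) (cf p w). Proof. exact: coord_field_smooth. Qed.
Let omlin p u : linear (om p u). Proof. by move=> a v w;
  rewrite /om /kahler_form Jlin glin. Qed.
Let smt W X : open W -> smooth_vfield A W X -> smooth_fun A W (app1 tau X).
Proof. by case: htau => _; apply. Qed.

Lemma lift_eta_linear z : linear (eta z).
Proof.
move=> a u v; rewrite /eta /lift_eta dt_linear dpi2_linear tlin scalerDr.
by rewrite addrACA.
Qed.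

Lemma lift_vectE z v : lift_vect tau z v = row_mx (- tau z.2 v)%:M v.
Proof. by rewrite row_scalarE /lift_vect /lift_xi scaleNr addrC. Qed.

Lemma lift_eta_lift z v : eta z (lift_vect tau z v) = 0.
Proof. by rewrite /eta /lift_eta lift_vectE dt_row dpi2_row addNr. Qed.

(** The product rule for [eta(X)]: on fields with constant components the [dt] part of [eta] is
    constant, so the derivative of [eta] itself is that of [tau] on the coordinate field frozen at
    the value of [X]. *)
Lemma lift_eta_is_diff z (X : vfield R (1 + m) (R * N)%type) dX :
  is_diff (chart PA z z) (in_chart PA z X) dX ->
  is_diff (chart PA z z) (app1 eta X \o chart_inv PA z)
    (fun v => 'd (app1 tau (cf z.2 (dpi2 (X z))) \o chart_inv A z.2) (chart A z.2
      z.2) (dpi2 v)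
      + eta z (dX v)).
Proof.
move=> dXz; set c := chart PA z z; set q := z.2.
have qq := sa_dom_center SA q.
pose L y w := dt w + app1 tau (cf q (dpi2 w)) (chart_inv A q (dpi2 y)).
pose dL v w := 'd (app1 tau (cf q (dpi2 w)) \o chart_inv A q) (chart A q q) (dpi2 v).
have linL y : linear (L y).
  move=> a u v; rewrite /L /app1 dt_linear dpi2_linear /cf coord_field_linear tlin.
  by rewrite scalerDr addrACA.
have dLc w : is_diff c (L^~ w) (dL^~ w).
  have d1 := smooth_fun_is_diff (smt (sa_dom_open SA q) (scf q (dpi2 w))) qq qq.
  rewrite -(dpi2_chart z z) in d1.
  have := is_diffD (is_diff_cst (dt w) c) (is_diff_dpi2 d1).
  by rewrite dpi2_chart => /is_diff_eq; apply; apply/funext => v; rewrite !fctE add0r.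
have := is_diff_applyW linL dLc dXz.
rewrite (in_chart_center SPA) => d.
have LcE w : L c w = eta z w.
  rewrite /L /c /app1 dpi2_chart (sa_chartK SA qq) /cf (coord_field_center SA).
  by [].
have -> : (fun v => 'd (app1 tau (cf q (dpi2 (X z))) \o chart_inv A q) (chart A q q)
  (dpi2 v)
      + eta z (dX v)) = (fun v => dL v (X z) + L c (dX v)).
  by apply/funext => v; rewrite LcE.
apply: near_is_diff d.
apply: (near_prod_chart SA (P := fun z' y =>
  L y (in_chart PA z X y) = app1 eta X z')) => z' zz'.
rewrite (prod_in_chart SA)// /L dt_row dpi2_row dpi2_chart (sa_chartK SA zz').
by rewrite /app1 /cf (coord_field_dtrans SA).
Qed.

(** * Lie derivatives along the lifted field *)

Section LiftedField.
Context {W : set N} {f : N -> R}.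
Hypothesis oW : open W.
Hypothesis sf : smooth_fun A W f.
Hypothesis df : forall q, W q ->
  is_diff (chart A q q) (f \o chart_inv A q) (fun w => - 2 * om q (V q) w).

(** The [dt]-component of [U], in contrast to [f], which is [eta(U)]. *)
Let u q := f q - app1 tau V q.
Let U : vfield R (1 + m) (R * N)%type := fun z =>
  lift_vfield tau V z + f z.2 *: lift_xi z.

Let UE : U = fun z => row_mx (u z.2)%:M (V z.2).
Proof.
apply/funext => z; rewrite /U /lift_vfield /lift_vect /lift_xi row_scalarE /u /app1.
by rewrite -addrA addrC; congr (_ + _); rewrite scalerBl addrC.
Qed.

Let U2 z : dpi2 (U z) = V z.2. Proof. by rewrite UE dpi2_row. Qed.

Let su : smooth_fun A W u.
Proof.
move=> p k; have oI := open_chart_im SA (p := p) oW.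
have st : smooth_fun A W (app1 tau V) by apply: smooth_fun_sub (smt openT sV).
have C := CkD oI (sf p k) (Ck_scale oI (Ck_cst k _ (-1 : R)) (st p k)).
by apply: Ck_eq oI _ C => y _; rewrite /u /= scaleN1r.
Qed.

Lemma lifted_field_smooth : smooth_vfield PA [set z | W z.2] U.
Proof.
rewrite UE; apply: smooth_vfield_row => //.
by apply: smooth_vfield_sub sV.
Qed.

Let dV q := 'd (in_chart A q V) (chart A q q).

Let du q w : W q -> 'd (u \o chart_inv A q) (chart A q q) w =
  - 2 * om q (V q) w - 'd (app1 tau V \o chart_inv A q) (chart A q q) w.
Proof.
move=> Wq; have qq := sa_dom_center SA q.
have d := is_diffB (df Wq) (smooth_fun_is_diff (smt openT sV) I qq).
exact: (is_diffE w d).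
Qed.

Lemma lifted_field_is_diff z : W z.2 -> is_diff (chart PA z z) (in_chart PA z U)
  (fun v => row_mx ('d (u \o chart_inv A z.2) (chart A z.2 z.2) (dpi2 v))%:M (dV z.2
    (dpi2 v))).
Proof.
move=> Wz; have qq := sa_dom_center SA z.2.
have d1 := smooth_fun_is_diff su Wz qq.
have d2 := smooth_vfield_is_diff sV (I : setT z.2) qq.
rewrite -(dpi2_chart z z) in d1 d2.
have := is_diff_row (is_diff_dpi2 d1) (is_diff_dpi2 d2).
rewrite dpi2_chart; apply: near_is_diff.
apply: (near_prod_chart SA (P := fun z' y => _ = in_chart PA z U y)) => z' zz'.
rewrite (prod_in_chart SA)// dpi2_chart UE dt_row dpi2_row.
by rewrite /= -(in_chartE SA)// (sa_chartK SA zz').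
Qed.

Let bracketUE z X dX : W z.2 -> is_diff (chart PA z z) (in_chart PA z X) dX ->
  bracket PA U X z = dX (U z) - row_mx ('d (u \o chart_inv A z.2) (chart A z.2 z.2)
    (dpi2 (X z)))%:M
    (dV z.2 (dpi2 (X z))).
Proof.
move=> Wz dXz; rewrite /bracket.
exact: (congr2 (fun a b => a - b) (is_diffE (U z) dXz) (is_diffE (X z)
  (lifted_field_is_diff Wz))).
Qed.

(** The terms [eta (dX (U z))] cancel, and the rest is [potential_diff], its right-hand side being
    absorbed by the choice of [df]. Differentiability at [z] is the natural hypothesis because the
    lemma is also applied to [phi X]. *)
Lemma lie_eta_at z X dX : W z.2 -> is_diff (chart PA z z) (in_chart PA z X) dX ->
  der PA U (app1 eta X) z = eta z (bracket PA U X z).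
Proof.
move=> Wz dXz; rewrite (bracketUE Wz dXz) (raw_linearB (lift_eta_linear z)).
apply: etrans (is_diffE (U z) (lift_eta_is_diff dXz)) _.
have := potential_diff hK z.2 (dpi2 (X z)) htau hpot sV.
rewrite {3}/eta /lift_eta dt_row dpi2_row (du _ Wz) U2.
move=> H; rewrite addrC; congr (_ + _).
move: H; rewrite -/om => H; apply/eqP; rewrite -addr_eq0.
by apply/eqP; rewrite mulNr -H /dV; ring.
Qed.

Let bracket2 z X dX : W z.2 -> is_diff (chart PA z z) (in_chart PA z X) dX ->
  dpi2 (bracket PA U X z) = dpi2 (dX (U z)) - dV z.2 (dpi2 (X z)).
Proof.
by move=> Wz dXz; rewrite (bracketUE Wz dXz) (raw_linearB dpi2_linear) dpi2_row.
Qed.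

(** The summand [eta * eta] is handled by [lie_eta_at] and the Leibniz rule. In the pullback of [g]
    the derivatives of [X] and [X'] cancel against the brackets, leaving [L_V g] on two coordinate
    fields. *)
Lemma lie_metric_at z X dX X' dX' : W z.2 ->
  is_diff (chart PA z z) (in_chart PA z X) dX ->
  is_diff (chart PA z z) (in_chart PA z X') dX' ->
  der PA U (app2 (lift_metric g tau) X X') z =
  app2 (lift_metric g tau) (bracket PA U X) X' z
  + app2 (lift_metric g tau) X (bracket PA U X') z.
Proof.
move=> Wz d d'; set c := chart PA z z; set q := z.2.
have qq := sa_dom_center SA q.
have oq := sa_dom_open SA q.
have [_ _ _ smg] := kahler_metric hK.
pose gl y w w' := app2 g (cf q w) (cf q w') (chart_inv A q (dpi2 y)).
pose dgl v w w' := 'd (app2 g (cf q w) (cf q w') \o chart_inv A q) (chart A q q)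
  (dpi2 v).
have linr (y : 'rV[R]_(1 + m)) w : linear (gl y w).
  by move=> a v v'; rewrite /gl /app2 /cf coord_field_linear glin.
have linl (y : 'rV[R]_(1 + m)) w : linear (gl y ^~ w).
  by move=> a v v'; rewrite /gl /app2 gsym /cf coord_field_linear glin !(gsym _
    (coord_field A q w _)).
have dglc w w' : is_diff c (fun y => gl y w w') (fun v => dgl v w w').
  have d1 := smooth_fun_is_diff (smg _ _ _ oq (scf q w) (scf q w')) qq qq.
  rewrite -(dpi2_chart z z) in d1.
  by have := is_diff_dpi2 d1; rewrite dpi2_chart.
have dp (Y : vfield R (1 + m) (R * N)%type) dY : is_diff c (in_chart PA z Y) dY ->
    is_diff c (fun y => dpi2 (in_chart PA z Y y)) (fun v => dpi2 (dY v)).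
  by move=> dYc; exact: (is_diff_comp dYc (is_diff_rV_linear _ dpi2_linear)).
have dg := is_diff_apply2 linr linl dglc (dp X dX d) (dp X' dX' d').
have e := lift_eta_is_diff d; have e' := lift_eta_is_diff d'.
have dG := is_diffD (is_diff_scale e e') dg.
pose G z' y := app1 eta X z' *: app1 eta X' z' +
  gl y (dpi2 (in_chart PA z X y)) (dpi2 (in_chart PA z X' y)).
have nE : \forall y \near c, G (chart_inv PA z y) y =
    (app2 (lift_metric g tau) X X' \o chart_inv PA z) y.
  apply: (near_prod_chart SA (P := fun z' y =>
    G z' y = app2 (lift_metric g tau) X X' z')) => z' zz'.
  rewrite /G /gl /app2.
  rewrite !(prod_in_chart SA)// !dpi2_row (sa_chartK SA zz').
  by rewrite /cf !(coord_field_dtrans SA).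
have dGz := near_is_diff nE dG.
apply: etrans (is_diffE (U z) dGz) _.
rewrite fctE /comp (sa_chartK SPA (sa_dom_center SPA z)) !(in_chart_center SPA).
have E1 := lie_eta_at Wz d; have E2 := lie_eta_at Wz d'.
rewrite -(is_diffE (U z) e) -(is_diffE (U z) e').
rewrite -/(der PA U (app1 eta X) z) -/(der PA U (app1 eta X') z) E1 E2.
rewrite /app1 /app2 /lift_metric -/eta (bracket2 Wz d) (bracket2 Wz d').
have glc w w' : gl c w w' = g q w w'.
  by rewrite /gl /app2 /c dpi2_chart (sa_chartK SA qq) /cf !(coord_field_center SA).
rewrite !glc /dgl U2.
have sVq : smooth_vfield A (dom A q) V by apply: smooth_vfield_sub sV.
(* [L_V g = 0] is tested on the coordinate fields whose values at [q] are the projections of [X z]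
   and [X' z]. *)
have [_ Lg _] := automorphism_lie hK hV.
have := Lg _ _ _ oq (@subsetT _ _) (scf q (dpi2 (X z))) (scf q (dpi2 (X' z))) q qq.
rewrite /app2 /der /cf !(bracket_coord_field_center SA) !(coord_field_center SA).
have gN v w : g q (- v) w = - g q v w by rewrite gsym (raw_linearN (glin _ _)) gsym.
have gB v v' w : g q (v - v') w = g q v w - g q v' w
  by rewrite gsym (raw_linearB (glin _ _)) !(gsym _ w).
rewrite gN (raw_linearN (glin _ _)) !opprK.
rewrite gB (raw_linearB (glin _ _)) /dV => H.
set a := 'd _ _ _ in H *.
apply/eqP; rewrite -subr_eq0; apply/eqP; rewrite -[RHS]H.
rewrite /GRing.scale /=; ring.
Qed.

(* Only the [dpi2]-component of the differential is made explicit: in [lie_phi_at]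
   the [dt]-component is recovered from [lie_eta_at], because [eta] vanishes on
   the image of [phi]. *)
Lemma lift_phi_is_diff z X dX : is_diff (chart PA z z) (in_chart PA z X) dX ->
  exists2 dY, is_diff (chart PA z z) (in_chart PA z (appe (lift_phi J tau) X)) dY &
    forall v, dpi2 (dY v) = 
      'd (in_chart A z.2 (appe J (cf z.2 (dpi2 (X z))))) (chart A z.2 z.2) (dpi2 v)
      + J z.2 (dpi2 (dX v)).
Proof.
move=> d; set c := chart PA z z; set q := z.2.
have qq := sa_dom_center SA q.
have oq := sa_dom_open SA q.
have [_ smJ] := kahler_endo hK.
pose Jw w := appe J (cf q w).
have sJw w : smooth_vfield A (dom A q) (Jw w) by exact: smJ.
(* Since [phi X] has blocks [- tau(J X)] and [J X], it is enough to apply the product rule to [tJ]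
   and [JJ], which express [tau(J .)] and [J] on coordinate fields. *)
pose tJ (y : 'rV[R]_(1 + m)) w := app1 tau (Jw w) (chart_inv A q (dpi2 y)).
pose JJ (y : 'rV[R]_(1 + m)) w := in_chart A q (Jw w) (dpi2 y).
have dp : is_diff c (fun y => dpi2 (in_chart PA z X y)) (fun v => dpi2 (dX v)).
  exact: (is_diff_comp d (is_diff_rV_linear _ dpi2_linear)).
have lint y : linear (tJ y).
  by move=> a v w; rewrite /tJ /Jw /app1 /appe /cf coord_field_linear Jlin tlin.
have linJ y : linear (JJ y).
  by move=> a v w; rewrite /JJ /Jw /in_chart /appe /cf coord_field_linear Jlin linearP.
have dt1 w : is_diff c (tJ^~ w) (fun v =>
  'd (app1 tau (Jw w) \o chart_inv A q) (chart A q q) (dpi2 v)).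
  have d1 := smooth_fun_is_diff (smt oq (sJw w)) qq qq.
  rewrite -(dpi2_chart z z) in d1.
  by have := is_diff_dpi2 d1; rewrite dpi2_chart.
have dJ1 w : is_diff c (JJ^~ w) (fun v =>
  'd (in_chart A q (Jw w)) (chart A q q) (dpi2 v)).
  have d1 := smooth_vfield_is_diff (sJw w) qq qq.
  rewrite -(dpi2_chart z z) in d1.
  by have := is_diff_dpi2 d1; rewrite dpi2_chart.
have d2 := is_diff_applyW lint dt1 dp.
have d3 := is_diff_applyW linJ dJ1 dp.
pose dJ v := 'd (in_chart A q (Jw (dpi2 (X z)))) (chart A q q) (dpi2 v) + J q (dpi2
  (dX v)).
have {}d3 : is_diff c (fun y => JJ y (dpi2 (in_chart PA z X y))) dJ.
  apply: is_diff_eq d3 _; apply/funext => v; rewrite /dJ (in_chart_center SPA).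
  congr (_ + _); rewrite /JJ /c dpi2_chart (in_chart_center SA) /Jw /appe /cf.
  by rewrite (coord_field_center SA).
have d2N : is_diff c (fun y => - tJ y (dpi2 (in_chart PA z X y))) _ := is_diffN d2.
have d4 := is_diff_row d2N d3.
exists (fun v => row_mx (- ('d (app1 tau (Jw (dpi2 (in_chart PA z X c))) \o
  chart_inv A q)
  (chart A q q) (dpi2 v) + tJ c (dpi2 (dX v))))%:M (dJ v)); last by move=> v;
    rewrite dpi2_row.
apply: near_is_diff d4.
apply: (near_prod_chart SA (P := fun z' y => _ = in_chart PA z _ y)) => z' zz'.
rewrite !(prod_in_chart SA)// /tJ /JJ dpi2_row dpi2_chart.
rewrite [appe (lift_phi J tau) X z']/appe /lift_phi lift_vectE dt_row dpi2_row.
rewrite (in_chartE SA)// (sa_chartK SA zz') /app1 /Jw /appe /cf.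
by rewrite !(coord_field_dtrans SA).
Qed.

Lemma lie_phi_at z X dX : W z.2 -> is_diff (chart PA z z) (in_chart PA z X) dX ->
  bracket PA U (appe (lift_phi J tau) X) z = appe (lift_phi J tau) (bracket PA U X) z.
Proof.
move=> Wz d; have [dY dYz dYE] := lift_phi_is_diff d.
set q := z.2; have qq := sa_dom_center SA q.
have phi2 Y z' : dpi2 (appe (lift_phi J tau) Y z') = J z'.2 (dpi2 (Y z')).
  by rewrite /appe /lift_phi lift_vectE dpi2_row.
apply/eqP; rewrite -subr_eq0; apply/eqP; set D := _ - _.
(* After projection, [J (dX (U z))] occurs in both brackets and cancels; what remains is [L_V J = 0]
   on the coordinate field through the projection of [X z]. *)
have D2 : dpi2 D = 0.
  rewrite /D (raw_linearB dpi2_linear) (bracket2 Wz dYz) !phi2 (bracket2 Wz d) dYE U2.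
  have [LJ _ _] := automorphism_lie hK hV.
  have := LJ _ _ (sa_dom_open SA q) (@subsetT _ _) (scf q (dpi2 (X z))) q qq.
  have Jq : appe J (cf q (dpi2 (X z))) q = J q (dpi2 (X z)).
    by rewrite /appe /cf (coord_field_center SA).
  rewrite {2}/appe (bracket_coord_field_center SA) /bracket Jq.
  rewrite (raw_linearN (Jlin _)) opprK (raw_linearB (Jlin _)) => H.
  rewrite -[RHS]H -/q /dV opprB [_ + J q (dpi2 (dX (U z))) - _]addrAC.
  by rewrite addrACA subrr addr0.
have De : eta z D = 0.
  rewrite /D (raw_linearB (lift_eta_linear z)) -(lie_eta_at Wz dYz).
  rewrite [appe (lift_phi J tau) _ z]/appe lift_eta_lift subr0.
  have -> : app1 eta (appe (lift_phi J tau) X) = cst 0.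
    by apply/funext => z'; exact: lift_eta_lift.
  exact: (is_diffE (U z) (is_diff_cst (0 : R) (chart PA z z))).
have Dt : dt D = 0.
  by move: De; rewrite /eta /lift_eta D2 (raw_linear0 (@tlin _)) addr0.
by rewrite -(row_dt_dpi2 D) Dt D2 row_scalar0.
Qed.

(** The differential of a function pulled back from [N] factors through [dpi2], which kills [xi]. *)
Lemma der_xi z : W z.2 -> der PA lift_xi (f \o snd) z = 0.
Proof.
move=> Wz; have d1 := df Wz; rewrite -(dpi2_chart z z) in d1.
apply: etrans (is_diffE (lift_xi z) (is_diff_dpi2 d1)) _.
rewrite /lift_xi dpi2_row.
by rewrite (raw_linear0 (@omlin _ _)) mulr0.
Qed.

(** In a product chart [xi] has the constant components [(1, 0)], and those of [U] do not depend on
    [t], so both terms of the bracket vanish. *)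
Lemma lie_xi z : W z.2 -> bracket PA U lift_xi z = 0.
Proof.
move=> Wz; have qq := sa_dom_center SA z.2.
have d : is_diff (chart PA z z) (in_chart PA z lift_xi) (cst 0).
  apply: near_is_diff (is_diff_cst (row_mx 1%:M 0 : 'rV[R]_(1 + m)) (chart PA z z)).
  apply: (near_prod_chart SA (P := fun z' y => _ = in_chart PA z _ y)) => z' zz'.
  by rewrite (prod_in_chart SA)// dt_row dpi2_row (raw_linear0 (dtrans_linear _ _ _)).
by rewrite (bracketUE Wz d) dpi2_row sub0r /dV !linear0 row_scalar0 oppr0.
Qed.

Lemma lifted_automorphism : acm_automorphism_on PA [set z | W z.2]
  (lift_phi J tau) lift_xi (lift_eta tau) (lift_metric g tau) U.
Proof.
have dX W' X z : smooth_vfield PA W' X -> W' z -> 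
    is_diff (chart PA z z) (in_chart PA z X) ('d (in_chart PA z X) (chart PA z z)).
  by move=> sX W'z; apply: (smooth_vfield_is_diff sX W'z); exact: sa_dom_center SPA z.
split; first exact: lifted_field_smooth.
split.
- move=> W' X oW' W'W sX z W'z.
  by rewrite (lie_phi_at (W'W z W'z) (dX _ _ _ sX W'z)) subrr.
- by move=> z; exact: lie_xi.
- move=> W' X oW' W'W sX z W'z.
  by rewrite (lie_eta_at (W'W z W'z) (dX _ _ _ sX W'z)) subrr.
- move=> W' X Y oW' W'W sX sY z W'z.
  rewrite (lie_metric_at (W'W z W'z) (dX _ _ _ sX W'z) (dX _ _ _ sY W'z)).
  by rewrite [X in X - _ - _]addrC addrK subrr.
Qed.

End LiftedField.
End Lift.

Unset Implicit Arguments.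

Theorem theorem6 (R : realType) (n : nat) (N : topologicalType)
    (A : atlas R (2 * n) N) (J : endo R (2 * n) N) (g : bilin R (2 * n) N)
    (tau : form1 R (2 * n) N) (V : vfield R (2 * n) N)
    (hK : is_kahler A J g)
    (htau : is_form1 A tau)
    (hpot : is_potential A (kahler_form J g) tau)
    (hV : kahler_automorphism A J g V) :
  forall z : (R * N)%type,
    exists (W : set (R * N)%type) (f : (R * N)%type -> R),
      [/\ open_nbhs z W,
          smooth_fun (prod_atlas A) W f,
          forall z', W z' -> der (prod_atlas A) lift_xi f z' = 0 &
          acm_automorphism_on (prod_atlas A) W
            (lift_phi J tau) lift_xi (lift_eta tau) (lift_metric g tau)
            (fun z' => lift_vfield tau V z' + f z' *: lift_xi z')].
Proof.
move=> z; have SA := manifold_smooth_atlas (kahler_manifold hK).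
have [W [f [oW Wz sf df]]] := local_primitive hK hV z.2.
(* The primitive lives on [N]; pulling it back makes it constant along the fibres, and its domain is
   a union of whole fibres. *)
exists [set z | W z.2], (f \o snd); split.
- by split=> //; exact: open_snd.
- exact: smooth_fun_snd.
- by move=> z'; exact: (der_xi hK df).
- exact: (lifted_automorphism hK htau hpot hV oW sf df).
Qed.
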